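(* There is an algorithm (CollisionCounting) which, given $f\in\mathbb{F}_q[x;r]$ monic of degree $r^2$, where $q=r^d$, correctly returns the number of collisions in decompositions of $f$, i.e. the number of pairs $(g,h)$ of monic polynomials in $\mathbb{F}_q[x;r]$ of degree $r$ with $f=g\circ h$. It requires an expected number of $O(d^3)\log r$ operations in $\mathbb{F}_r$ using a randomized algorithm, or $d^{O(1)}\log r$ operations in $\mathbb{F}_r$ with a deterministic algorithm (assuming the Extended Riemann Hypothesis).
   Context: $r$ is a power of a prime $p$ (with $r>1$) and $q=r^d$ for a positive integer $d$. $\mathbb{F}_q[x;r]=\{\sum_{0\le i\le n}a_ix^{r^i}: n\ge 0,\ a_i\in\mathbb{F}_q\}$ is the ring (under addition and composition) of $r$-additive polynomials over $\mathbb{F}_q$. The input $f=x^{r^2}+ax^r+bx$ is given sparsely by its coefficients $a,b\in\mathbb{F}_q$. *)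

(* Defs.v *)
From HB Require Import structures.
From mathcomp Require Import all_boot all_order all_algebra all_field.
From mathcomp Require Import complex.
From mathcomp Require Import all_classical all_reals all_analysis.

Set Implicit Arguments.
Unset Strict Implicit.
Unset Printing Implicit Defensive.
Import Order.TTheory GRing.Theory Num.Theory.
Import numFieldNormedType.Exports.
Local Open Scope classical_set_scope.
Local Open Scope ring_scope.

Definition additive_poly (K : fieldType) (r : nat) (f : {poly K}) : Prop :=
  exists (n : nat) (a : nat -> K), f = \sum_(i < n.+1) a i *: 'X^(r ^ i)%N.

Definition monic_additive_of_degree (K : fieldType) (r k : nat)
    (f : {poly K}) : Prop :=
  [/\ additive_poly r f, f \is monic & size f = k.+1].

Definition decompositions (K : fieldType) (r : nat) (f : {poly K}) :
    set ({poly K} * {poly K}) :=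
  [set gh | [/\ monic_additive_of_degree r r gh.1,
                monic_additive_of_degree r r gh.2 &
                f = gh.1 \Po gh.2]].

(* A problem instance.  F_r is an arbitrary finite field (so r is automatically
   a prime power > 1), and F_q is represented in the usual way as F_r[t]/(mu)
   for a monic irreducible polynomial mu of degree d over F_r. *)
Record instance := Instance {
  Fr : finFieldType;
  mu : {poly Fr};
  mu_irr : monic_irreducible_poly mu;
  target : {poly {poly %/ mu with mu_irr}};
  target_spec : monic_additive_of_degree #|Fr| (#|Fr| ^ 2) target
}.

Definition inst_r (I : instance) : nat := #|Fr I|.
Definition inst_d (I : instance) : nat := (size (mu I)).-1.

Definition collision_count (I : instance) (n : nat) : Prop :=
  (decompositions (inst_r I) (target I) #= `I_n)%card.

(* Algorithms are finite programs, independent of r and d, for a random access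
   machine with a memory of natural numbers (for indices, counters and
   control) and a memory of field elements, both with indirect addressing.
   Field elements can only be copied, combined by the field operations, tested
   for zero, or drawn at random; the only built-in field constants are 0, 1. *)

Inductive nat_op := OAdd | OSub | OMul | ODiv | OMod.
Inductive field_op := FAdd | FSub | FMul | FDiv.

Inductive nexp :=
| NConst of nat
| NLoad of nexp
| NOp of nat_op & nexp & nexp.

Inductive prog :=
| Skip
| Seq of prog & prog
| If of nexp & prog & prog
| While of nexp & prog
| NStore of nexp & nexp             (* nat address, value *)
| FConst of nexp & bool             (* field address, constant 0 or 1 *)
| FCopy of nexp & nexp              (* destination, source *)
| FOp of field_op & nexp & nexp & nexp (* destination, operands *)
| FIsZero of nexp & nexp            (* nat destination, field source *)
| FRand of nexp.                    (* destination of a uniform element *)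

Fixpoint deterministic (P : prog) : bool :=
  match P with
  | Seq P1 P2 | If _ P1 P2 => deterministic P1 && deterministic P2
  | While _ P1 => deterministic P1
  | FRand _ => false
  | _ => true
  end.

Definition nat_op_sem (o : nat_op) : nat -> nat -> nat :=
  match o with
  | OAdd => addn | OSub => subn | OMul => muln | ODiv => divn | OMod => modn
  end.

Fixpoint neval (m : nat -> nat) (e : nexp) : nat :=
  match e with
  | NConst n => n
  | NLoad e1 => m (neval m e1)
  | NOp o e1 e2 => nat_op_sem o (neval m e1) (neval m e2)
  end.

(* Division by 0 returns 0. *)
Definition field_op_sem (F : fieldType) (o : field_op) (x y : F) : F :=
  match o with
  | FAdd => x + y | FSub => x - y | FMul => x * y | FDiv => x / y
  end.

Definition update (T : Type) (m : nat -> T) (i : nat) (v : T) : nat -> T :=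
  fun j => if j == i then v else m j.

(* [code] is the list of commands that remain to be executed; [cost] counts the
   operations in the field performed so far. *)
Record config (F : fieldType) := Config {
  code : seq prog;
  nmem : nat -> nat;
  fmem : nat -> F;
  cost : nat
}.

Definition halted (F : fieldType) (s : config F) : bool := nilp (code s).

(* One step; [w] is the field element drawn if the step is a random choice, and
   is ignored otherwise.  Arithmetic operations, zero tests and random choices
   in the field cost 1; everything else is free. *)
Definition step (F : fieldType) (s : config F) (w : F) : config F :=
  let: Config k n f c := s in
  match k with
  | [::] => s
  | P :: k =>
    match P with
    | Skip => Config k n f c
    | Seq P1 P2 => Config (P1 :: P2 :: k) n f c
    | If e P1 P2 =>
        Config ((if neval n e != 0%N then P1 else P2) :: k) n f c
    | While e P1 =>
        Config (if neval n e != 0%N then P1 :: While e P1 :: k else k) n f c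
    | NStore a e => Config k (update n (neval n a) (neval n e)) f c
    | FConst a b => Config k n (update f (neval n a) (b%:R)) c
    | FCopy a x => Config k n (update f (neval n a) (f (neval n x))) c
    | FOp o a x y =>
        Config k n
          (update f (neval n a)
             (field_op_sem o (f (neval n x)) (f (neval n y)))) c.+1
    | FIsZero a x =>
        Config k (update n (neval n a) (nat_of_bool (f (neval n x) == 0)))
          f c.+1
    | FRand a => Config k n (update f (neval n a) w) c.+1
    end
  end.

Definition run (F : fieldType) (s : config F) (w : seq F) : config F :=
  foldl (@step F) s w.

(* Input: r and d in cells 0 and 1 of the nat memory; in the field memory, the
   low d coefficients of mu, then the d coordinates of a and of b in the basis
   1, t, .., t^(d-1), where target = x^(r^2) + a x^r + b x. *)
Definition input_nmem (I : instance) : nat -> nat :=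
  nth 0%N [:: inst_r I; inst_d I].

Definition input_fmem (I : instance) : nat -> Fr I :=
  let a : {poly Fr I} := (target I)`_(inst_r I) in
  let b : {poly Fr I} := (target I)`_1 in
  nth 0 (mkseq (fun i => (mu I)`_i) (inst_d I) ++
         mkseq (fun i => a`_i) (inst_d I) ++
         mkseq (fun i => b`_i) (inst_d I)).

Definition exec (P : prog) (I : instance) (w : seq (Fr I)) : config (Fr I) :=
  run (Config [:: P] (input_nmem I) (@input_fmem I) 0) w.

Definition output (F : fieldType) (s : config F) : nat := nmem s 0.

(* Whatever the random choices, a halting run outputs the right number. *)
Definition partially_correct (P : prog) : Prop :=
  forall (I : instance) (w : seq (Fr I)),
    halted (exec P w) -> collision_count I (output (exec P w)).

Definition always_halts (P : prog) : Prop :=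
  forall I : instance, exists n : nat,
    forall w : n.-tuple (Fr I), halted (exec P w).

Section Randomized.
Variable R : realType.

(* Mean over a uniformly distributed sequence of n random field elements. *)
Definition mean (F : finFieldType) (n : nat) (X : n.-tuple F -> R) : R :=
  (\sum_(w : n.-tuple F) X w) / (#|F| ^ n)%:R.

Definition almost_surely_halts (P : prog) : Prop :=
  forall I : instance,
    (fun n => mean (fun w : n.-tuple (Fr I) => (halted (exec P w))%:R))
      @ \oo --> (1 : R).

(* The cost of the first n steps increases with n, hence the expectation of the
   total cost is the supremum of the expected costs of the first n steps. *)
Definition expected_cost (P : prog) (I : instance) : \bar R :=
  ereal_sup (range (fun n =>
    (mean (fun w : n.-tuple (Fr I) => (cost (exec P w))%:R))%:E)).

End Randomized.

(* The Extended Riemann Hypothesis: all zeros in the critical strip of the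
   Riemann zeta function and of the Dirichlet L-functions lie on the critical
   line. *)
Section ERH.
Variable R : realType.
Local Open Scope complex_scope.

(* k^(-s) for k > 0 *)
Definition nat_cpow_opp (k : nat) (s : R[i]) : R[i] :=
  let t := complex.Im s * ln k%:R in
  (k%:R `^ (- complex.Re s))%:C * (cos t -i* sin t).

(* Sum over k >= 1; real and imaginary parts are summed separately. *)
Definition csum (u : nat -> R[i]) : R[i] :=
  limn (fun n => \sum_(1 <= k < n) complex.Re (u k)) +i*
  limn (fun n => \sum_(1 <= k < n) complex.Im (u k)).

Definition dirichlet_character (N : nat) (chi : nat -> R[i]) : Prop :=
  [/\ (0 < N)%N,
      chi 1%N = 1,
      forall m n, chi (m * n)%N = chi m * chi n,
      forall n, chi (n + N)%N = chi n &
      forall n, (chi n != 0) = coprime n N].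

Definition principal (N : nat) (chi : nat -> R[i]) : Prop :=
  forall n, coprime n N -> chi n = 1.

(* For non-principal chi, this series converges for Re s > 0. *)
Definition dirichlet_L (chi : nat -> R[i]) (s : R[i]) : R[i] :=
  csum (fun k => chi k * nat_cpow_opp k s).

(* The zeta function for 0 < Re s < 1, continued by means of the alternating
   series (1 - 2^(1-s)) zeta(s) = 1 - 2^(-s) + 3^(-s) - ..., which converges for
   Re s > 0; 1 - 2^(1-s) has no zero with Re s < 1. *)
Definition zeta (s : R[i]) : R[i] :=
  csum (fun k => (-1) ^+ k.-1 * nat_cpow_opp k s)
  / (1 - 2 * nat_cpow_opp 2 s).

Definition zeros_on_critical_line (L : R[i] -> R[i]) : Prop :=
  forall s : R[i], 0 < complex.Re s < 1 -> L s = 0 -> complex.Re s = 2^-1.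

(* Imprimitive characters are harmless: passing to the inducing primitive
   character only removes zeros with Re s = 0. *)
Definition extended_Riemann_hypothesis : Prop :=
  zeros_on_critical_line zeta /\
  forall (N : nat) (chi : nat -> R[i]),
    dirichlet_character N chi -> ~ principal N chi ->
    zeros_on_critical_line (dirichlet_L chi).

End ERH.

(* Main.v *)
(* Let f = x^(r^2) + a x^r + b x. Since (x^r + c x) o (x^r - y x) equals
   x^(r^2) + (c - y^r) x^r - c y x, the decompositions of f correspond to the roots y
   in F_q of y^(r+1) + a y + b. If b = 0 there are two of them, or one if a = 0.
   Otherwise f is separable, and v |-> v^(r-1) identifies these roots with the
   F_r-lines of the plane ker f that are stable under the q-Frobenius sigma.

   Repeated right division by f gives x^(r^i) = A_i x^r + B_i x modulo f, from which
   the characteristic polynomial Q = X^2 - T X + D of sigma is read off. If sigma is a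
   scalar, all r + 1 lines are stable; otherwise there is one stable line for each root
   of Q in F_r. Writing X^r = u X + v modulo Q, there is one root if u = 0, there are
   two if (u, v) = (1, 0), and none otherwise.

   All this is deterministic and takes O(d) r-th powers in F_q, each costing O(log r)
   multiplications of O(d^2) operations in F_r; hence one program serves for both
   claims. *)

Require Import Defs.
From mathcomp Require Import all_boot all_order all_algebra all_field.
From mathcomp Require Import all_classical all_reals all_analysis.
From mathcomp Require Import ring zify.
Import Order.TTheory GRing.Theory Num.Theory.
Import numFieldNormedType.Exports.
Local Open Scope ring_scope.

Set Implicit Arguments.
Unset Strict Implicit.
Unset Printing Implicit Defensive.

(** * Counting roots of [y^(r+1) + a y + b] *)

(** The kernel of f lies in a splitting field, while the program can compute in F_q only. The link
    is the matrix M with rows [frob_red r a b d.+1] and [frob_red r a b d]. For x in the kernel it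
    sends (x^r, x) to (sigma(x)^r, sigma(x)). Its entries are in F_q and depend on a and b alone. M
    need not have entries in F_r, but it is conjugate to its entrywise r-th power, so T and D do lie
    in F_r. No F_r-vector space is ever set up: dimensions are replaced by cardinalities, through an
    inequality between a set, a kernel and an image for additive maps. Lines are counted through
    their nonzero vectors, r - 1 on each. The existence of a root c of Q in F_r puts the other root
    T - c in F_r as well. This makes the remainder of X^r modulo Q sufficient to separate the cases,
    in every characteristic. The program never draws a random element, so its number of steps and
    its cost are determined by the instance. Hence a bound for every run is also a bound for the
    expectation. *)

(** The r-th power of A x^r + B x, with x^(r^2) replaced by -a x^r - b x. *)
Definition skew_step (K : nzRingType) (r : nat) (a b : K) (x : K * K) : K * K :=
  (x.2 ^+ r - a * x.1 ^+ r, - b * x.1 ^+ r).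

(* [frob_red r a b i = (A, B)] means that [x^(r^i)] is congruent to [A x^r + B x]
   modulo [x^(r^2) + a x^r + b x], for division in the ring of additive
   polynomials. *)
Definition frob_red (K : nzRingType) (r : nat) (a b : K) (i : nat) : K * K :=
  iter i (skew_step r a b) (0, 1).

(* Trace and determinant over F_r of the q-Frobenius on the kernel of
   [x^(r^2) + a x^r + b x], where [q = r^d]. *)
Definition frob_trace (K : nzRingType) r (a b : K) d : K :=
  (frob_red r a b d.+1).1 + (frob_red r a b d).2.

Definition frob_det (K : nzRingType) r (a b : K) d : K :=
  (frob_red r a b d.+1).1 * (frob_red r a b d).2
  - (frob_red r a b d.+1).2 * (frob_red r a b d).1.

Lemma pchar_exp_inj (F : fieldType) r :
  (0 < r)%N -> [pchar F].-nat r -> injective (fun x : F => x ^+ r).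
Proof.
move=> r0 rp x y /eqP; rewrite -subr_eq0 -exprNn_pchar // -exprDn_pchar // expf_eq0.
by rewrite subr_eq0 => /andP[_ /eqP].
Qed.

Lemma pchar_natr0 (F : finFieldType) r :
  (1 < r)%N -> [pchar F].-nat r -> r%:R = 0 :> F.
Proof.
move=> r_gt1 + ; have [p pr pc] := finPcharP F.
rewrite (eq_pnat _ (pcharf_eq pc)) => /p_natP[k ek].
apply/eqP; rewrite -(dvdn_pcharf pc) ek dvdn_exp //.
by case: k ek r_gt1 => // ->.
Qed.

(** Subtracting one point of a fibre embeds that fibre into the kernel. This stands in for
    rank-nullity; [u] has to be additive on [S] only. *)
Lemma leq_card_ker_im (V : finZmodType) (S im : {set V}) (u : V -> V) :
    {in S &, forall v w, v - w \in S} -> {in S &, {morph u : v w / v - w}} ->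
    {in S, forall v, u v \in im} ->
  (#|S| <= #|[set v in S | u v == 0%R]| * #|im|)%N.
Proof.
move=> SB uB u_im; pose k := #|[set v in S | u v == 0]|; rewrite -/k.
have fib w : (#|[set v in S | u v == w]| <= k)%N.
  have [->|[v0]] := set_0Vmem [set v in S | u v == w]; first by rewrite cards0.
  rewrite inE => /andP[Sv0 /eqP uv0].
  rewrite -(card_imset _ (@subIr _ v0)); apply/subset_leq_card/fintype.subsetP => x.
  case/imsetP => v; rewrite inE => /andP[Sv /eqP uv] ->.
  by rewrite inE (SB _ _ Sv Sv0) uB // uv uv0 subrr eqxx.
rewrite mulnC -sum_nat_const -sum1_card (partition_big u [in im]) //=.
by apply: leq_sum => w _; rewrite sum1dep_card fib.
Qed.

Lemma card_kernel_skew (L : finFieldType) (r : nat) (al be : L) :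
  (1 < r)%N -> (al != 0) || (be != 0) ->
  (#|[set v : L | (al * v ^+ r + be * v == 0)%R]| <= r)%N.
Proof.
move=> r1 nz; pose p := al *: 'X^r + be *: 'X.
have p0 : p != 0.
  apply: contraTneq nz => p0; rewrite negb_or !negbK.
  have := congr1 (fun q : {poly L} => q`_r) p0.
  have := congr1 (fun q : {poly L} => q`_1) p0.
  rewrite !coefD !coefZ !coefXn !coefX !coef0 eqxx eqxx.
  rewrite eq_sym [r == 1%N]eq_sym ltn_eqF // !mulr0 !mulr1 addr0 add0r => -> ->.
  by rewrite eqxx.
have sp : (size p <= r.+1)%N.
  rewrite (leq_trans (size_polyD _ _)) // geq_max.
  rewrite (leq_trans (size_scale_leq _ _)) ?size_polyXn //=.
  by rewrite (leq_trans (size_scale_leq _ _)) // size_polyX ltnW.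
rewrite cardE -ltnS (leq_trans _ sp) // max_poly_roots ?enum_uniq //.
by apply/allP => v; rewrite mem_enum inE rootE !hornerE.
Qed.

(** * Stable lines of the q-Frobenius, in a field containing the kernel of f *)

Section EigenlineCount.
Variables (L : finFieldType) (r d : nat) (a b : L).
Hypotheses (r_gt1 : (1 < r)%N) (r_pchar : [pchar L].-nat r).
Local Notation q := (r ^ d)%N.
Hypotheses (aq : a ^+ q = a) (bq : b ^+ q = b) (b_neq0 : b != 0).

Let expD n (x y : L) : [pchar L].-nat n -> (x + y) ^+ n = x ^+ n + y ^+ n.
Proof. exact: exprDn_pchar. Qed.
Let expN n (x : L) : [pchar L].-nat n -> (- x) ^+ n = - x ^+ n.
Proof. by move=> nn; apply: exprNn_pchar. Qed.
Let expB n (x y : L) : [pchar L].-nat n -> (x - y) ^+ n = x ^+ n - y ^+ n.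
Proof. by move=> nn; rewrite expD // expN. Qed.
Let rX_pchar i : [pchar L].-nat (r ^ i)%N.
Proof. by rewrite pnatX r_pchar. Qed.
Let q_pchar := rX_pchar d.
Let r_gt0 : (0 < r)%N. Proof. exact: ltnW. Qed.
Let expr0r : 0 ^+ r = 0 :> L. Proof. by rewrite expr0n eqn0Ngt r_gt0. Qed.
Let expr0q : 0 ^+ q = 0 :> L.
Proof. by rewrite expr0n expn_eq0 eqn0Ngt r_gt0. Qed.

Let Fr_q (c : L) : c ^+ r = c -> c ^+ q = c.
Proof. by move=> cr; elim: (d) => // i IH; rewrite expnSr exprM IH. Qed.

Let A i := (frob_red r a b i).1.
Let B i := (frob_red r a b i).2.

Let AS i : A i.+1 = B i ^+ r - a * A i ^+ r. Proof. by []. Qed.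
Let BS i : B i.+1 = - b * A i ^+ r. Proof. by []. Qed.

(* The recurrence of [frob_red] unrolled from the other end. *)
Let rows_left i : A i.+2 = - a ^+ (r ^ i) * A i.+1 - b ^+ (r ^ i) * A i /\
  B i.+2 = - a ^+ (r ^ i) * B i.+1 - b ^+ (r ^ i) * B i.
Proof.
elim: i => [|i [IHA IHB]].
  split; rewrite !(AS, BS) /A /B /= !expn0 !expr1 !expr1n !expr0r;
    by rewrite ?mulr0 ?subr0 ?expr1n ?expr0r; ring.
have step (X : nat -> L) : X i.+2 = - a ^+ (r ^ i) * X i.+1 - b ^+ (r ^ i) * X i ->
    X i.+2 ^+ r = - a ^+ (r ^ i.+1) * X i.+1 ^+ r - b ^+ (r ^ i.+1) * X i ^+ r.
  by move=> ->; rewrite !(expB, exprMn, expN) // -!exprM -!expnSr.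
rewrite (AS i.+2) (BS i.+2) (step A) // (step B) // (AS i.+1) (BS i.+1) (AS i) (BS i).
by split; ring.
Qed.

Let T := frob_trace r a b d.
Let D := frob_det r a b d.

(* Entrywise form of [M^(r) C = C M] for the matrices [M] with rows
   [frob_red r a b d.+1], [frob_red r a b d] and [C] with rows [(-a, -b)], [(1, 0)]:
   as [M^(r)] and [M] are conjugate, the trace and determinant of [M] are in F_r. *)
Let conj_rel : [/\ B d.+1 ^+ r = a * A d.+1 ^+ r - a * A d.+1 - b * A d,
  b * A d.+1 ^+ r = a * B d.+1 + b * B d,
  B d ^+ r = A d.+1 + a * A d ^+ r & b * A d ^+ r = - B d.+1].
Proof.
have [hA hB] := rows_left d; rewrite aq bq (AS d.+1) in hA; rewrite aq bq (BS d.+1) in hB.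
split.
- by rewrite -[LHS](subrK (a * A d.+1 ^+ r)) hA; ring.
- by rewrite -[LHS]opprK -mulNr hB; ring.
- by rewrite AS; ring.
- by rewrite BS; ring.
Qed.

(** The matrix [C] of [conj_rel] has determinant b, so cancelling b here and in [frob_det_Fr] takes
    the place of inverting [C]. *)
Lemma frob_trace_Fr : T ^+ r = T.
Proof.
have [h1 h2 h3 h4] := conj_rel; apply: (mulfI b_neq0).
have -> : T = A d.+1 + B d by [].
rewrite expD // mulrDr h2 h3.
have -> : b * (A d.+1 + a * A d ^+ r) = b * A d.+1 + a * (b * A d ^+ r) by ring.
by rewrite h4; ring.
Qed.

Lemma frob_det_Fr : D ^+ r = D.
Proof.
have [] := conj_rel; rewrite /D /frob_det -/(A d.+1) -/(B d) -/(B d.+1) -/(A d).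
move: (A d.+1) (B d.+1) (A d) (B d) => x y z w h1 h2 h3 h4.
apply: (mulfI b_neq0); rewrite expB // !exprMn.
have -> : b * (x ^+ r * w ^+ r - y ^+ r * z ^+ r) =
  (b * x ^+ r) * w ^+ r - y ^+ r * (b * z ^+ r) by ring.
rewrite h4 h1 h3.
have -> : b * x ^+ r * (x + a * z ^+ r) - (a * x ^+ r - a * x - b * z) * - y =
  (b * x ^+ r) * x + a * x ^+ r * (b * z ^+ r + y) - (a * x + b * z) * y by ring.
by rewrite h4 h2; ring.
Qed.

Let AB_d : A d ^+ q = A d /\ B d ^+ q = B d.
Proof.
suff H i : A i ^+ q = A i /\ B i ^+ q = B i by apply: H.
elim: i => [|i [hA hB]]; first by rewrite /A /B /= expr1n expr0q.
rewrite AS BS expB // !exprMn expN // aq bq.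
by rewrite -[(B i ^+ r) ^+ _]exprAC -[(A i ^+ r) ^+ _]exprAC hA hB.
Qed.

Let fv (v : L) := v ^+ (r ^ 2) + a * v ^+ r + b * v.
Let V := [set v : L | fv v == 0].

Let VE v : v \in V -> v ^+ (r ^ 2) = - a * v ^+ r - b * v.
Proof.
rewrite inE => /eqP fv0; apply: (addIr (a * v ^+ r + b * v)).
by rewrite addrA [LHS]fv0; ring.
Qed.

Let frobV i v : v \in V -> v ^+ (r ^ i) = A i * v ^+ r + B i * v.
Proof.
move=> Vv; elim: i => [|i IH]; first by rewrite /A /B /= expn0 expr1; ring.
rewrite expnSr exprM IH expD // !exprMn -exprM -[(r * r)%N]/(r ^ 2)%N VE //.
by rewrite AS BS; ring.
Qed.

Let sigma (v : L) := v ^+ q.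

(** Cayley-Hamilton for M, read in the second coordinate of the vector (v^r, v). Applying sigma
    again amounts to applying M again because the entries of M are fixed by the q-th power. *)
Let sigma2 v : v \in V -> sigma (sigma v) = T * sigma v - D * v.
Proof.
move=> Vv; have [Aq Bq] := AB_d.
have s1 : sigma v = A d * v ^+ r + B d * v by apply: frobV.
have s1r : (sigma v) ^+ r = A d.+1 * v ^+ r + B d.+1 * v.
  by rewrite /sigma -exprM -expnSr; apply: frobV.
rewrite {1}s1 /sigma expD // !exprMn Aq Bq exprAC -/(sigma v) s1r s1.
rewrite /T /D /frob_trace /frob_det -!/(A _) -!/(B _); ring.
Qed.

Let V_sub : {in V &, forall v w, v - w \in V}.
Proof.
move=> v w; rewrite !inE /fv => /eqP hv /eqP hw; rewrite !expB //.
apply/eqP; rewrite -[RHS](subrr 0) -{1}hv -hw; ring.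
Qed.

Let V_scale (c v : L) : c ^+ r = c -> v \in V -> c * v \in V.
Proof.
move=> cr; rewrite !inE /fv => /eqP hv; rewrite !exprMn.
rewrite -[(r ^ 2)%N]/(r * r)%N !exprM !cr -exprM.
by apply/eqP; rewrite -[RHS](mulr0 c) -hv -[(r ^ 2)%N]/(r * r)%N; ring.
Qed.

Let V_sigma v : v \in V -> sigma v \in V.
Proof.
rewrite !inE /fv /sigma => /eqP hv.
rewrite exprAC [(v ^+ q) ^+ r]exprAC -{1}aq -{1}bq -!exprMn -!expD // hv.
by rewrite expr0q.
Qed.

Hypothesis card_V : #|V| = (r ^ 2)%N.
Let Fr := [set c : L | c ^+ r == c].

Let Vc (c : L) := [set v in V | sigma v - c * v == 0].
Let Z := [set c in Fr | c ^+ 2 - T * c + D == 0].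

Let conj_Z c : c \in Z -> T - c \in Z.
Proof.
rewrite !inE => /andP[/eqP cr /eqP cD].
by rewrite expB // frob_trace_Fr cr eqxx /= -{1}cD; apply/eqP; ring.
Qed.

(** Once [A d] vanishes, sigma is multiplication by [B d] on [V] and [A d.+1] equals [B d ^+ r]. The
    second test thus says that this multiplier lies in F_r. *)
Let scalar := (A d == 0) && (A d.+1 == B d).

Let Vc_le c : ~~ scalar -> c \in Z -> (#|Vc c| <= r)%N.
Proof.
move=> nscal Zc; have nz : (A d != 0) || (B d - c != 0).
  rewrite -negb_and; apply: contra nscal => /andP[/eqP A0].
  rewrite subr_eq0 => /eqP Bc; rewrite /scalar A0 eqxx /= AS A0.
  rewrite expr0r mulr0 subr0 Bc.
  by move: Zc; rewrite !inE => /andP[].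
apply: leq_trans (card_kernel_skew r_gt1 nz); apply/subset_leq_card/fintype.subsetP => v.
rewrite [v \in Vc c]inE => /andP[Vv /eqP e]; rewrite inE -e /sigma frobV //.
by apply/eqP; ring.
Qed.

(* [Vc c] and [Vc (T - c)] have at most [r] elements each, and [sigma - c] maps
   [V], of size [r^2], to [Vc (T - c)] with kernel [Vc c]. *)
Let card_Vc c : ~~ scalar -> c \in Z -> #|Vc c| = r.
Proof.
move=> nscal Zc; apply/eqP; rewrite eqn_leq Vc_le //=.
have /andP[/eqP cr /eqP cD] : (c ^+ r == c) && (c ^+ 2 - T * c + D == 0).
  by move: Zc; rewrite !inE.
have := @leq_card_ker_im _ V (Vc (T - c)) (fun v => sigma v - c * v) V_sub.
rewrite -/(Vc c) card_V => H.
have : (r ^ 2 <= #|Vc c| * #|Vc (T - c)%R|)%N.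
  apply: H => [v w _ _|v Vv]; first by rewrite /sigma expB //; ring.
  rewrite inE V_sub ?V_sigma ?V_scale //=.
  have -> : sigma (sigma v - c * v) = sigma (sigma v) - c * sigma v.
    by rewrite /sigma expB // exprMn (Fr_q cr).
  rewrite sigma2 //; apply/eqP; rewrite -[RHS](mul0r (- v)) -cD; ring.
move/leq_trans/(_ (leq_mul (leqnn _) (Vc_le nscal (conj_Z Zc)))).
by rewrite -[(r ^ 2)%N]/(r * r)%N leq_pmul2r.
Qed.

Let Y := [set y : L | (y ^+ r.+1 + a * y + b == 0) && (y ^+ q == y)].
(** The nonzero vectors on stable lines. They are counted twice: by line in [card_WY], by eigenvalue
    in [card_WZ]. *)
Let W := [set v in V | (v != 0) && ((sigma v / v) ^+ r == sigma v / v)].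

Let V0 : 0 \in V.
Proof. by rewrite inE /fv !expr0n expn_eq0 eqn0Ngt r_gt0 !mulr0 !addr0. Qed.

Let line (y : L) := [set v in V | v ^+ r - y * v == 0].

(** A root y splits f as (x^r + (a + y^r) x) o (x^r - y x). So v |-> v^r - y v maps [V] into the
    kernel of the left factor, with kernel [line y]. Both kernels have at most r elements and the
    product of their sizes is at least r^2. *)
Let card_line y : y \in Y -> #|line y| = r.
Proof.
rewrite inE => /andP[/eqP Py _].
have le1 : (#|line y| <= r)%N.
  apply: leq_trans (_ : #|[set v : L | (1 * v ^+ r + (- y) * v == 0)%R]| <= r)%N; last first.
    by apply: card_kernel_skew; rewrite ?oner_neq0.
  apply/subset_leq_card/fintype.subsetP => v; rewrite !inE => /andP[_ /eqP e].
  by rewrite mul1r mulNr e.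
apply/eqP; rewrite eqn_leq le1 /=.
have le2 : (#|[set v : L | (1 * v ^+ r + (a + y ^+ r) * v == 0)%R]| <= r)%N.
  by apply: card_kernel_skew; rewrite ?oner_neq0.
have := @leq_card_ker_im _ V [set v : L | (1 * v ^+ r + (a + y ^+ r) * v == 0)%R]
   (fun v => v ^+ r - y * v) V_sub.
rewrite -/(line y) card_V => H.
have : (r ^ 2 <= #|line y| * #|[set v : L | (1 * v ^+ r + (a + y ^+ r) * v == 0)%R]|)%N.
  apply: H => [v w _ _|v Vv]; first by rewrite expB //; ring.
  rewrite inE expB // exprMn -exprM -[(r * r)%N]/(r ^ 2)%N VE //.
  apply/eqP; transitivity (- (y ^+ r.+1 + a * y + b) * v); last by rewrite Py; ring.
  by rewrite exprS; ring.
move/leq_trans/(_ (leq_mul (leqnn _) le2)).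
by rewrite -[(r ^ 2)%N]/(r * r)%N leq_pmul2r.
Qed.

(** Dividing f(v) = 0 by v gives the equation for y = v^(r-1). The condition y^q = y is, after
    clearing denominators, that sigma(v) / v is fixed by the r-th power. *)
Let W_line v : v \in W -> (v ^+ r / v) \in Y.
Proof.
rewrite !inE => /and3P[/eqP Vv v0 /eqP sr]; apply/andP; split.
  apply/eqP/(mulIf v0); rewrite mul0r -Vv /fv.
  rewrite exprSr exprMn exprVn -exprM -[(r * r)%N]/(r ^ 2)%N.
  have vr0 : v ^+ r != 0 by rewrite expf_neq0.
  by field; rewrite v0 vr0.
have s0 : sigma v != 0 by rewrite expf_neq0.
move/eqP: sr; rewrite !exprMn !exprVn exprAC -![v ^+ q]/(sigma v).
by rewrite !eqr_div ?expf_neq0 // [v ^+ r * _]mulrC.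
Qed.

(* Sending [v] to [v^(r-1)] maps the kernel minus 0 onto the roots of
   [y^(r+1) + a y + b], with fibres of size [r - 1]; fixed roots come from the
   eigenvectors of [sigma]. *)
Let card_WY : #|W| = (#|Y| * r.-1)%N.
Proof.
rewrite -sum_nat_const -sum1_card (partition_big (fun v => v ^+ r / v) [in Y]) //=.
apply: eq_bigr => y Yy; rewrite sum1dep_card.
have l0 : 0 \in line y by rewrite inE V0 expr0r mulr0 subr0 eqxx.
have := cardsD1 0 (line y); rewrite l0 card_line // => /(congr1 predn) /= ->.
apply: eq_card => v.
move: Yy; rewrite !inE => /andP[_ /eqP yq]; case: (eqVneq v 0) => [->|v0] /=.
  by rewrite !andbF.
rewrite subr_eq0 -[_ / _ == y](inj_eq (mulIf v0)) divfK //.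
case: (v ^+ r =P y * v) => [e|]; rewrite ?andbF // !andbT.
have -> : (sigma v / v) ^+ r == sigma v / v; last by rewrite andbT.
rewrite exprMn exprVn /sigma exprAC e exprMn yq; apply/eqP; field.
rewrite v0 /=; apply: contraTneq (expf_neq0 r v0) => y0.
by rewrite e y0 mul0r eqxx.
Qed.

Let card_WZ : ~~ scalar -> #|W| = (#|Z| * r.-1)%N.
Proof.
move=> nscal.
rewrite -sum_nat_const -sum1_card (partition_big (fun v => sigma v / v) [in Z]) /=.
  apply: eq_bigr => c Zc; rewrite sum1dep_card.
  have l0 : 0 \in Vc c by rewrite inE V0 /sigma expr0q mulr0 subr0 eqxx.
  have := cardsD1 0 (Vc c); rewrite l0 card_Vc // => /(congr1 predn) /= ->.
  apply: eq_card => v.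
  move: Zc; rewrite !inE => /andP[cr _]; case: (eqVneq v 0) => [->|v0] /=.
    by rewrite !andbF.
  rewrite subr_eq0 -[_ / v == c](inj_eq (mulIf v0)) divfK //.
  by case: (sigma v =P c * v) => [e|]; rewrite ?andbF // e mulfK // cr !andbT.
move=> v; rewrite inE => /and3P[Vv v0 /eqP cr]; rewrite inE inE cr eqxx /=.
set c := sigma v / v in cr *; have e : sigma v = c * v by rewrite divfK.
apply/eqP/(mulIf v0); rewrite mul0r.
have := sigma2 Vv; rewrite {1}e {1}/sigma exprMn Fr_q // -/(sigma v) e => e2.
by rewrite -[RHS](subrr (c * (c * v))) {2}e2; ring.
Qed.

Lemma card_right_components :
  #|Y| = if scalar then r.+1 else #|Z|.
Proof.
have r1 : (0 < r.-1)%N by rewrite -ltnS prednK.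
apply/eqP; rewrite -(eqn_pmul2r r1) -card_WY.
case: ifPn => [/andP[/eqP A0 /eqP AB]|/card_WZ->//].
have Br : B d ^+ r = B d.
  by rewrite -[RHS]AB AS A0 expr0r mulr0 subr0.
have := cardsD1 0 V; rewrite V0 card_V => /(congr1 predn) /= e.
(* For a scalar sigma, [W] is [V] without 0, and r^2 - 1 = (r + 1)(r - 1). *)
apply/eqP; transitivity (r ^ 2).-1; last first.
  by rewrite -subn1 -[X in (_ - X)%N](exp1n 2) subn_sqr addn1 subn1 mulnC.
rewrite e; apply: eq_card => v; rewrite finset.in_setD1 finset.in_set.
case: (boolP (v \in V)) => [Vv|_]; rewrite ?andbF //.
case: eqVneq => [->|v0] //=.
by rewrite /sigma frobV // A0 mul0r add0r mulfK // Br eqxx.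
Qed.

End EigenlineCount.

(** * Roots in F_r of a quadratic Q, read off from X^r modulo Q *)

Definition quad_poly (K : nzRingType) (T D : K) : {poly K} := 'X^2 - T *: 'X + D%:P.

Lemma size_quad_poly (K : nzRingType) (T D : K) : size (quad_poly T D) = 3.
Proof.
rewrite /quad_poly -addrA size_polyDl ?size_polyXn // ltnS.
rewrite (leq_trans (size_polyD _ _)) // geq_max size_polyN.
rewrite (leq_trans (size_scale_leq _ _)) ?size_polyX //=.
by rewrite (leq_trans (size_polyC_leq1 _)).
Qed.

Lemma monic_quad_poly (K : nzRingType) (T D : K) : quad_poly T D \is monic.
Proof.
rewrite monicE lead_coefE size_quad_poly /= !coefE /=.
by rewrite mulr0 subr0 addr0.
Qed.

Section QuadraticCount.
Variables (L : finFieldType) (r : nat) (T D u v : L) (g : {poly L}).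
Hypotheses (r_gt1 : (1 < r)%N) (r_pchar : [pchar L].-nat r).
Hypotheses (Tr : T ^+ r = T) (Dr : D ^+ r = D).
Hypothesis card_Fr : #|[set c : L | c ^+ r == c]| = r.
Hypothesis Xr_mod : 'X^r = u *: 'X + v%:P + g * quad_poly T D.

Let Fr := [set c : L | c ^+ r == c].
Let Z := [set c : L | (c ^+ r == c) && (c ^+ 2 - T * c + D == 0)].

Let root_quad c : root (quad_poly T D) c = (c ^+ 2 - T * c + D == 0).
Proof. by rewrite rootE /quad_poly !hornerE. Qed.

Let Z_value c : c \in Z -> u * c + v = c.
Proof.
rewrite inE -root_quad => /andP[/eqP cr /rootP cQ].
have := congr1 (fun p => p.[c]) Xr_mod.
by rewrite /= hornerD hornerM cQ mulr0 addr0 !hornerE cr.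
Qed.

(** If X^r is congruent to a constant w^r, then Q divides X^r - w^r = (X - w)^r, so Q = (X - w)^2.
    It remains to see that w lies in F_r. *)
Let card_double : u = 0 -> #|Z| = 1%N.
Proof.
move=> u0.
have frob_inj := pchar_exp_inj (ltnW r_gt1) r_pchar.
have [w wr] : exists w, w ^+ r = v by exists (invF frob_inj v); apply: (f_invF frob_inj).
have dvd : quad_poly T D %| ('X - w%:P) ^+ r.
  have pn : [pchar {poly L}].-nat r by rewrite (eq_pnat _ (@pchar_poly L)).
  rewrite exprDn_pchar // exprNn_pchar // -polyC_exp wr Xr_mod u0 scale0r add0r.
  by rewrite addrC addKr dvdp_mull.
have /dvdp_exp_XsubCP[k _ Qk] := dvd.
have k2 : k = 2%N by have /eqp_size := Qk; rewrite size_quad_poly size_exp_XsubC => -[].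
have Qw : quad_poly T D = ('X - w%:P) ^+ 2.
  by apply/eqP; rewrite -eqp_monic ?monic_quad_poly ?monic_exp ?monicXsubC // -k2.
have rootQ c : (c ^+ 2 - T * c + D == 0) = (c == w).
  by rewrite -root_quad Qw rootE !hornerE expf_eq0 subr_eq0.
have eval_w c : c ^+ 2 - T * c + D = (c - w) ^+ 2.
  by have := congr1 (fun p => p.[c]) Qw; rewrite /quad_poly !hornerE.
have eD : D = w ^+ 2 by have := eval_w 0; rewrite expr0n mulr0 subrr !add0r sqrrN.
have eT : T = w *+ 2.
  have -> : T = 1 ^+ 2 + D - (1 ^+ 2 - T * 1 + D) by ring.
  by rewrite eval_w eD; ring.
suff -> : Z = [set w] by rewrite cards1.
apply/setP => c; rewrite !inE rootQ; case: (c =P w) => [->|]; rewrite ?andbF // andbT.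
(* In characteristic 2 the trace, being 2w, says nothing about w. The square (w^r - w)^2 = D^r - T^r
   w + w^2 uses the determinant too, and equals Q(w) = 0. *)
rewrite -subr_eq0 -[_ == 0](expf_eq0 (w ^+ r - w) 2); apply/eqP.
transitivity (D ^+ r - T ^+ r * w + w ^+ 2); last by rewrite Tr Dr eT eD; ring.
by rewrite eT eD mulr2n (exprDn_pchar w w r_pchar) exprAC; ring.
Qed.

Let card_split : u = 1 -> v = 0 -> #|Z| = 2%N.
Proof.
move=> u1 v0.
have prodFr : 'X^r - 'X = \prod_(c <- enum Fr) ('X - c%:P) :> {poly L}.
  have sz : size ('X^r - 'X : {poly L}) = r.+1.
    by rewrite size_polyDl size_polyXn // size_polyN size_polyX.
  rewrite [LHS](@all_roots_prod_XsubC _ _ (enum Fr)).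
  - by rewrite lead_coefDl ?lead_coefXn ?scale1r // size_polyXn size_polyN size_polyX.
  - by rewrite sz -cardE card_Fr.
  - by apply/allP => c; rewrite mem_enum inE rootE !hornerE subr_eq0.
  - by rewrite uniq_rootsE enum_uniq.
have dvd : quad_poly T D %| \prod_(c <- enum Fr) ('X - c%:P).
  by rewrite -prodFr Xr_mod u1 v0 scale1r addr0 addrC addKr dvdp_mull.
have [m Qm] := dvdp_prod_XsubC dvd.
have um : uniq (mask m (enum Fr)) by rewrite mask_uniq ?enum_uniq.
have sm : size (mask m (enum Fr)) = 2%N.
  by have /eqp_size := Qm; rewrite size_quad_poly size_prod_XsubC => -[].
rewrite -sm -(card_uniqP um); apply: eq_card => c; rewrite inE -root_quad (eqp_root Qm).
rewrite root_prod_XsubC andb_idl // => /mem_mask.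
by rewrite mem_enum inE.
Qed.

(** The other root T - c is also in F_r. If it differs from c, the affine map z |-> u z + v has two
    fixed points and is the identity. If it equals c, differentiating [Xr_mod] at this double root
    gives 0 = u, as X^r has derivative 0. *)
Let root_coefs c : c \in Z -> u = 0 \/ u = 1 /\ v = 0.
Proof.
move=> Zc; have Zc' : T - c \in Z.
  move: Zc; rewrite !inE => /andP[/eqP cr /eqP cQ].
  rewrite exprDn_pchar // exprNn_pchar // Tr cr eqxx /= -{1}cQ; apply/eqP; ring.
have [e|ne] := eqVneq (T - c) c; [left | right].
  have eT : T = c *+ 2 by rewrite mulr2n -{1}e subrK.
  have eD : D = c ^+ 2.
    move: Zc; rewrite !inE eT => /andP[_ /eqP cQ].
    by rewrite -[LHS]subr0 -cQ; ring.
  have r0 := pchar_natr0 r_gt1 r_pchar.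
  have := congr1 (fun q : {poly L} => (q^`()).[c]) Xr_mod.
  rewrite /= derivXn hornerMn -mulr_natr r0 mulr0 !derivD derivM derivZ derivX derivC.
  have Qc : (quad_poly T D).[c] = 0.
    by rewrite /quad_poly !hornerE eT eD; ring.
  have dQc : ((quad_poly T D)^`()).[c] = 0.
    by rewrite /quad_poly !(poly.derivE, hornerE) eT; ring.
  by rewrite !hornerD !hornerM Qc dQc !mulr0 !addr0 !hornerE => ->.
have h1 := Z_value Zc; have h2 := Z_value Zc'.
have u1 : u = 1.
  have dz : T - c - c != 0 by rewrite subr_eq0.
  apply: (mulIf dz); rewrite mul1r.
  have -> : u * (T - c - c) = (u * (T - c) + v) - (u * c + v) by ring.
  by rewrite h1 h2.
by split=> //; apply: (addrI c); rewrite addr0 -{2}h1 u1 mul1r.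
Qed.

Lemma card_quad_roots :
  #|Z| = if u == 0 then 1%N else if (u == 1) && (v == 0) then 2%N else 0%N.
Proof.
case: eqVneq => [/card_double //|u0].
case: ifPn => [/andP[/eqP u1 /eqP v0]|nuv]; first exact: card_split.
apply: eq_card0 => c; apply/negP => /root_coefs[u0'|[u1 v0]].
  by rewrite u0' eqxx in u0.
by rewrite u1 v0 !eqxx in nuv.
Qed.
End QuadraticCount.

(** * Descent from a splitting field of f to F_q *)

Lemma frob_red_morph (K L : nzRingType) (phi : {rmorphism K -> L}) r (a b : K) i :
  (frob_red r (phi a) (phi b) i).1 = phi (frob_red r a b i).1 /\
  (frob_red r (phi a) (phi b) i).2 = phi (frob_red r a b i).2.
Proof.
elim: i => [|i [IH1 IH2]]; first by rewrite /frob_red /= rmorph0 rmorph1.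
have e (M : nzRingType) (x y : M) :
  frob_red r x y i.+1 = skew_step r x y (frob_red r x y i) by [].
rewrite !e /skew_step /= IH1 IH2.
by rewrite rmorphB !rmorphM !rmorphXn rmorphN.
Qed.

Section Descent.
Variables (K : finFieldType) (r d : nat) (a b : K).
Hypotheses (r_gt1 : (1 < r)%N) (r_pchar : [pchar K].-nat r).
Hypotheses (card_K : #|K| = (r ^ d)%N) (b_neq0 : b != 0).

Let f : {poly K} := 'X^(r ^ 2) + a *: 'X^r + b *: 'X.

Let r2_gt1 : (1 < r ^ 2)%N.
Proof. by rewrite -(exp1n 2) ltn_exp2r. Qed.

Let f_neq0 : f != 0.
Proof.
apply: contraNneq b_neq0 => f0.
have := congr1 (fun q : {poly K} => q`_1) f0.
by rewrite !coefE /= (ltn_eqF r_gt1) (ltn_eqF r2_gt1) mulr0 mulr1 !add0r => ->.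
Qed.

Let size_f : size f = (r ^ 2).+1.
Proof.
rewrite /f -addrA size_polyDl ?size_polyXn // ltnS.
rewrite (leq_trans (size_polyD _ _)) // geq_max.
have r_lt : (r < r ^ 2)%N by rewrite -[ltnLHS]expn1 ltn_exp2l.
rewrite (leq_trans (size_scale_leq _ _)) ?size_polyXn //=.
by rewrite (leq_trans (size_scale_leq _ _)) ?size_polyX.
Qed.

Let separable_f : separable_poly f.
Proof.
rewrite unlock.
have mulrn_r (p : {poly K}) : p *+ r = 0.
  by rewrite -mulr_natr -polyC_natr (pchar_natr0 r_gt1 r_pchar) mulr0.
have -> : f^`() = b%:P.
  by rewrite /f !poly.derivE !mulrnA !mulrn_r scaler0 !add0r alg_polyC.
by rewrite -[b%:P]mulr1 mul_polyC coprimepZr // coprimep1.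
Qed.

Section InExtension.
Variables (L : finFieldType) (phi : {rmorphism K -> L}) (rs : seq L).
Hypothesis f_rs : map_poly phi f %= \prod_(z <- rs) ('X - z%:P).

Let card_V :
  #|[set v : L | v ^+ (r ^ 2) + phi a * v ^+ r + phi b * v == 0]| = (r ^ 2)%N.
Proof.
have urs : uniq rs.
  rewrite -separable_prod_XsubC -(eqp_separable f_rs) separable_map.
  exact: separable_f.
have := eqp_size f_rs; rewrite size_map_poly size_f size_prod_XsubC => -[r2E].
rewrite [RHS]r2E.
rewrite -(card_uniqP urs); apply: eq_card => v; rewrite inE.
rewrite -(root_prod_XsubC rs) -(eqp_root f_rs) rootE /f !rmorphD /= !map_polyZ /=.
by rewrite !map_polyXn map_polyX !hornerE.
Qed.

(** The image of [K] consists of q solutions of x^q = x, and there are at most q of them: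
    [card_kernel_skew] is used with exponent q. *)
Let fixed_phi (x : L) : (x ^+ (r ^ d) == x) = (x \in [set phi y | y : K]).
Proof.
have q1 : (1 < r ^ d)%N by rewrite -card_K finNzRing_gt1.
suff /setP/(_ x) -> : [set phi y | y : K] = [set x : L | x ^+ (r ^ d) == x] by rewrite inE.
apply/eqP; rewrite eqEcard; apply/andP; split.
  apply/fintype.subsetP => z /imsetP[y _ ->]; rewrite inE -rmorphXn -card_K.
  by rewrite expf_card.
rewrite card_imset ?card_K //; last exact: fmorph_inj.
apply: leq_trans (_ : #|[set z : L | (1 * z ^+ (r ^ d) + (-1) * z == 0)%R]| <= _)%N.
  by apply/subset_leq_card/fintype.subsetP => z; rewrite !inE mul1r mulN1r subr_eq0.
by apply: card_kernel_skew; rewrite ?oner_neq0.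
Qed.

(** The sets counted in [L] come from [K]: their elements are fixed by the q-th power, by definition
    for the y and by iterating c^r = c for the c. The pairs [frob_red] of the images of a and b are
    images too. *)
Lemma card_roots_extension :
  #|[set y : K | y ^+ r.+1 + a * y + b == 0]| =
  if ((frob_red r a b d).1 == 0) && ((frob_red r a b d.+1).1 == (frob_red r a b d).2)
  then r.+1 else
  #|[set c : K | (c ^+ r == c) && (c ^+ 2 - frob_trace r a b d * c + frob_det r a b d == 0)]|.
Proof.
have r_pcharL : [pchar L].-nat r by rewrite (eq_pnat _ (fmorph_pchar phi)).
have fix_phi y : phi y ^+ (r ^ d) = phi y.
  by apply/eqP; rewrite fixed_phi imset_f.
have b0 : phi b != 0 by rewrite fmorph_eq0.
have := card_right_components r_gt1 r_pcharL (fix_phi a) (fix_phi b) b0 card_V.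
have red1 i : (frob_red r (phi a) (phi b) i).1 = phi (frob_red r a b i).1.
  by have [] := frob_red_morph phi r a b i.
have red2 i : (frob_red r (phi a) (phi b) i).2 = phi (frob_red r a b i).2.
  by have [] := frob_red_morph phi r a b i.
have eT : frob_trace r (phi a) (phi b) d = phi (frob_trace r a b d).
  by rewrite /frob_trace red1 red2 [RHS]rmorphD.
have eD : frob_det r (phi a) (phi b) d = phi (frob_det r a b d).
  by rewrite /frob_det !red1 !red2 [RHS]rmorphB !rmorphM.
rewrite eT eD !red1 !red2 fmorph_eq0 (inj_eq (fmorph_inj phi)).
move: (frob_trace r a b d) (frob_det r a b d) => T D H.
have quad_phi c : phi c ^+ 2 - phi T * phi c + phi D = phi (c ^+ 2 - T * c + D).
  by rewrite rmorphD rmorphB rmorphXn rmorphM.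
have poly_phi c : phi c ^+ r.+1 + phi a * phi c + phi b = phi (c ^+ r.+1 + a * c + b).
  by rewrite !rmorphD rmorphXn rmorphM.
rewrite -(card_imset _ (fmorph_inj phi)) -[X in _ = if _ then _ else X](card_imset _ (fmorph_inj phi)).
transitivity #|[set y : L | (y ^+ r.+1 + phi a * y + phi b == 0) & y ^+ (r ^ d) == y]|.
  apply: eq_card => z; rewrite inE fixed_phi; apply/imsetP/andP.
    case=> y; rewrite inE => /eqP fy ->; split; last exact: imset_f.
    by rewrite poly_phi fy rmorph0.
  case=> fz /imsetP[y _ ez]; exists y => //; move: fz.
  by rewrite inE ez poly_phi fmorph_eq0.
rewrite H; case: ifP => // _; apply: eq_card => z; rewrite inE; apply/andP/imsetP.
  case; rewrite inE => /eqP zr zQ.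
  have : z ^+ (r ^ d) == z by apply/eqP; elim: (d) => // i IH; rewrite expnSr exprM IH.
  rewrite fixed_phi => /imsetP[c _ ec]; exists c => //; move: zr zQ.
  rewrite inE ec -rmorphXn quad_phi fmorph_eq0 => /fmorph_inj ->.
  by rewrite eqxx.
case=> c; rewrite [c \in _]inE => /andP[/eqP cr /eqP cQ] ->.
by rewrite inE -rmorphXn quad_phi cr cQ rmorph0.
Qed.
End InExtension.

Lemma card_roots_skew :
  #|[set y : K | y ^+ r.+1 + a * y + b == 0]| =
  if ((frob_red r a b d).1 == 0) && ((frob_red r a b d.+1).1 == (frob_red r a b d).2)
  then r.+1 else
  #|[set c : K | (c ^+ r == c) && (c ^+ 2 - frob_trace r a b d * c + frob_det r a b d == 0)]|.
Proof.
have [L0 [rs f_rs _]] := FinSplittingFieldFor f_neq0.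
exact: (@card_roots_extension (FinFieldExtType L0) (in_alg L0 : {rmorphism K -> L0}) rs f_rs).
Qed.

Lemma frob_trace_det_Fr :
  frob_trace r a b d ^+ r = frob_trace r a b d /\
  frob_det r a b d ^+ r = frob_det r a b d.
Proof.
have fixK (x : K) : x ^+ (r ^ d) = x by rewrite -card_K expf_card.
by split; [apply: frob_trace_Fr | apply: frob_det_Fr].
Qed.
End Descent.

(** * Decompositions of additive polynomials *)

Notation quot I := {poly %/ mu I with mu_irr I}.

Lemma coef_additive_poly (K : fieldType) r (f : {poly K}) j :
  additive_poly r f -> f`_j != 0 -> exists i, j = (r ^ i)%N.
Proof.
move=> [n [c ->]]; rewrite coef_sum => nz.
have [i ne] : exists i : 'I_n.+1, j == (r ^ i)%N.
  apply/existsP; apply: contraNT nz => /existsPn ne.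
  by apply/eqP/big1 => i _; rewrite coefZ coefXn (negPf (ne i)) mulr0.
by exists i; apply/eqP.
Qed.

Lemma monic_additive1P (K : fieldType) r (h : {poly K}) : (1 < r)%N ->
  monic_additive_of_degree r r h <-> exists c, h = 'X^r + c *: 'X.
Proof.
move=> r1; split=> [[addh /monicP lh sh]|[c ->]].
  exists h`_1; apply/polyP => j; rewrite !coefE.
  have [->|jr] := eqVneq j r.
    by rewrite -lh lead_coefE sh /= (gtn_eqF r1) mulr0 addr0.
  have [->|j1] := eqVneq j 1%N; first by rewrite mulr1 add0r.
  rewrite mulr0 addr0; apply: contraNeq jr => nz.
  have [i ji] := coef_additive_poly addh nz; subst j.
  have : (r ^ i <= r ^ 1)%N.
    by rewrite expn1 -ltnS -sh ltnNge; apply: contra nz => le; rewrite nth_default.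
  rewrite leq_exp2l //; case: i nz j1 => [|[|//]]; rewrite ?expn1 ?eqxx //.
have sz : size ('X^r + c *: 'X) = r.+1.
  by rewrite size_polyDl size_polyXn // (leq_ltn_trans (size_scale_leq _ _)) ?size_polyX.
split=> //.
  exists 1%N, (fun i => if i is 0%N then c else 1).
  by rewrite big_ord_recr big_ord1 /= expn0 expr1 expn1 scale1r addrC.
by apply/monicP; rewrite lead_coefE sz /= !coefE eqxx (gtn_eqF r1) mulr0 addr0.
Qed.

Lemma monic_additive2_form (K : fieldType) r (f : {poly K}) : (1 < r)%N ->
  monic_additive_of_degree r (r ^ 2) f -> f = 'X^(r ^ 2) + f`_r *: 'X^r + f`_1 *: 'X.
Proof.
move=> r1 [addf /monicP lf sf].
have r12 : (r < r ^ 2)%N by rewrite -[ltnLHS]expn1 ltn_exp2l.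
apply/polyP => j; rewrite !coefE.
have [->|j2] := eqVneq j (r ^ 2)%N.
  by rewrite -{1}lf lead_coefE sf /= (gtn_eqF r12) (gtn_eqF (ltn_trans r1 r12)) !mulr0 !addr0.
have [->|jr] := eqVneq j r.
  by rewrite (gtn_eqF r1) mulr1 mulr0 addr0 add0r.
have [->|j1] := eqVneq j 1%N; first by rewrite mulr1 mulr0 !add0r.
rewrite !mulr0 !addr0; apply: contraNeq j2 => nz.
have [i ji] := coef_additive_poly addf nz; subst j.
have : (r ^ i <= r ^ 2)%N.
  by rewrite -ltnS -sf ltnNge; apply: contra nz => le; rewrite nth_default.
by rewrite leq_exp2l //; case: i nz j1 jr => [|[|[|//]]]; rewrite ?expn1 ?eqxx.
Qed.

Section Decompositions.
Variables (K : finFieldType) (r : nat) (a b : K).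
Hypotheses (r_gt1 : (1 < r)%N) (r_pchar : [pchar K].-nat r).
Let f : {poly K} := 'X^(r ^ 2) + a *: 'X^r + b *: 'X.

Let comp_additive1 (c e : K) :
  ('X^r + c *: 'X) \Po ('X^r + e *: 'X) =
  'X^(r ^ 2) + (e ^+ r + c) *: 'X^r + (c * e) *: 'X.
Proof.
have pn : [pchar {poly K}].-nat r by rewrite (eq_pnat _ (@pchar_poly K)).
rewrite comp_polyD comp_polyZ comp_polyX comp_Xn_poly exprDn_pchar //.
rewrite exprZn -exprM -[(r * r)%N]/(r ^ 2)%N scalerDr scalerDl scalerA.
by rewrite !addrA.
Qed.

Let coef_inj (a' b' c' e' : K) :
  'X^(r ^ 2) + a' *: 'X^r + b' *: 'X = 'X^(r ^ 2) + c' *: 'X^r + e' *: 'X ->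
  a' = c' /\ b' = e'.
Proof.
rewrite -!addrA => /addrI e.
have := congr1 (fun p : {poly K} => p`_r) e; have := congr1 (fun p : {poly K} => p`_1) e.
by rewrite !coefE !eqxx (gtn_eqF r_gt1) (ltn_eqF r_gt1) !mulr0 !mulr1 !addr0 !add0r.
Qed.

Definition split_at (y : K) : {poly K} * {poly K} :=
  ('X^r + (a + y ^+ r) *: 'X, 'X^r - y *: 'X).

(** Comparing coefficients leaves only the right factor x^r - y x free. Listing the roots y yields
    the bijection with an initial segment of the naturals. *)
Lemma decompositions_card :
  (decompositions r f #= `I_#|[set y : K | (y ^+ r.+1 + a * y + b == 0)%R]%SET|)%card.
Proof.
set Y := finset _.
pose F (i : nat) := split_at (nth 0 (enum Y) i).
have Finj : {in `I_#|Y|%classic &, injective F}.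
  move=> i j; rewrite !inE /= => iY jY [_] /addrI/oppr_inj e.
  have := congr1 (fun p : {poly K} => p`_1) e; rewrite !coefE !mulr1 => /eqP.
  by rewrite nth_uniq ?enum_uniq -?cardE // => /eqP.
have <- : (F @` `I_#|Y|)%classic = decompositions r f; last exact: inj_card_eq.
apply/seteqP; split=> [_ [i /= iY <-]|[g h] [/=]].
  have : nth 0 (enum Y) i \in Y by rewrite -mem_enum mem_nth // -cardE.
  rewrite /F; move: (nth _ _ _) => y; rewrite inE => /eqP Py; split => /=.
  - by apply/monic_additive1P => //; exists (a + y ^+ r).
  - by apply/monic_additive1P => //; exists (- y); rewrite scaleNr.
  rewrite -scaleNr comp_additive1 exprNn_pchar // (_ : - y ^+ r + (a + y ^+ r) = a); last by ring.
  congr (_ + _ *: _); apply/eqP; rewrite -subr_eq0 -Py exprS; apply/eqP.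
  by rewrite mulrN opprK mulrDl [y ^+ r * y]mulrC [RHS]addrC [a * y + _]addrC.
move=> /(monic_additive1P _ r_gt1)[c ->] /(monic_additive1P _ r_gt1)[e ->].
rewrite comp_additive1 => /coef_inj[ea eb].
have Yy : - e \in Y.
  by rewrite inE exprS exprNn_pchar // ea eb; apply/eqP; ring.
exists (index (- e) (enum Y)); rewrite /= ?cardE ?index_mem ?mem_enum //.
rewrite /F nth_index ?mem_enum // /split_at ea exprNn_pchar // scaleNr opprK.
by congr (_ + _ *: _, _); ring.
Qed.
End Decompositions.

Lemma card_finField_pchar (F : finFieldType) : [pchar F].-nat #|F|.
Proof.
have [p pr pc] := finPcharP F; rewrite (eq_pnat _ (pcharf_eq pc)).
by rewrite [#|F|](card_pprimeChar pc) pnatX pnat_id.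
Qed.

(** * Powers modulo a quadratic, and the count as a formula in F_q *)

Section PairArithmetic.
Variables (K : comNzRingType) (T D : K).

(* A pair [(u, v)] stands for the class of [u X + v] modulo [X^2 - T X + D]. *)
Definition quad_mul (x y : K * K) : K * K :=
  (x.1 * y.1 * T + (x.1 * y.2 + x.2 * y.1), x.2 * y.2 - x.1 * y.1 * D).

Definition quad_exp (x : K * K) (n : nat) : K * K := iter n (quad_mul x) (0, 1).

Lemma quad_mulC : commutative quad_mul.
Proof. by move=> [x1 x0] [y1 y0]; rewrite /quad_mul /=; congr pair; ring. Qed.

Lemma quad_mulA : associative quad_mul.
Proof.
by move=> [x1 x0] [y1 y0] [z1 z0]; rewrite /quad_mul /=; congr pair; ring.
Qed.

Lemma quad_mul1 : left_id (0, 1) quad_mul.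
Proof. by move=> [x1 x0]; rewrite /quad_mul /=; congr pair; ring. Qed.

Lemma quad_expS x n : quad_exp x n.+1 = quad_mul x (quad_exp x n).
Proof. by []. Qed.

Lemma quad_exp_sqr x n : quad_exp x n.*2 = quad_exp (quad_mul x x) n.
Proof.
by elim: n => // n IH; rewrite doubleS !quad_expS IH quad_mulA.
Qed.

(** Constants never meet the modulus. Hence the routine that computes X^r modulo Q also computes
    r-th powers in F_q, before T and D are known. *)
Lemma quad_exp_const (x : K) n : quad_exp (0, x) n = (0, x ^+ n).
Proof.
elim: n => [|n IH]; first by rewrite expr0.
by rewrite quad_expS IH /quad_mul /= exprS; congr pair; ring.
Qed.

Lemma quad_exp_X n : exists g : {poly K},
  'X^n = (quad_exp (1, 0) n).1 *: 'X + ((quad_exp (1, 0) n).2)%:P + g * quad_poly T D.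
Proof.
elim: n => [|n [g IH]]; first by exists 0; rewrite /= scale0r mul0r addr0 add0r.
rewrite quad_expS; move: (quad_exp _ _) IH => [u v] /= IH.
exists (u%:P + 'X * g); rewrite exprS IH /quad_poly /quad_mul /=.
rewrite -!mul_polyC !(polyCD, polyCM, polyCN, polyC1, polyC0); ring.
Qed.
End PairArithmetic.

(** The case distinction in the form the machine runs it: equalities in the field are written as
    zero tests of differences. *)
Definition collision_formula (K : finFieldType) (r d : nat) (a b : K) : nat :=
  if b == 0 then if a == 0 then 1%N else 2%N
  else if ((frob_red r a b d).1 == 0)
    && ((frob_red r a b d.+1).1 - (frob_red r a b d).2 == 0) then r.+1
  else
    let x := quad_exp (frob_trace r a b d) (frob_det r a b d) (1, 0) r in
    if x.1 == 0 then 1%N else if (x.1 - 1 == 0) && (x.2 == 0) then 2%N else 0%N.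

Lemma card_roots_formula (K : finFieldType) (r d : nat) (a b : K) :
  (1 < r)%N -> [pchar K].-nat r -> #|K| = (r ^ d)%N ->
  #|[set c : K | (c ^+ r == c)%R]%SET| = r ->
  #|[set y : K | (y ^+ r.+1 + a * y + b == 0)%R]%SET| = collision_formula r d a b.
Proof.
move=> r1 rp cK cFr; rewrite /collision_formula.
case: (eqVneq b 0) => [->|b0].
  have r0 : (0 < r)%N by apply: ltnW.
  have frob_inj := pchar_exp_inj r0 rp.
  (* For b = 0 the equation is y (y^r + a) = 0. Its second root w is the only r-th root of -a, and w
     = 0 exactly when a = 0. *)
  pose w := invF frob_inj (- a); have wr : w ^+ r = - a by apply: (f_invF frob_inj).
  have -> : [set y : K | (y ^+ r.+1 + a * y + 0 == 0)%R]%SET = [set 0; w]%SET.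
    apply/setP => y; rewrite !inE addr0 exprSr -mulrDl mulf_eq0 orbC; congr orb.
    by rewrite -[a]opprK -wr subr_eq0 (inj_eq frob_inj).
  rewrite cards2; suff -> : (0 != w) = (a != 0) by case: eqP.
  by rewrite -[0 == w](inj_eq frob_inj) /= wr expr0n eqn0Ngt r0 eq_sym oppr_eq0.
rewrite (card_roots_skew a r1 rp cK b0) subr_eq0; case: ifP => // _.
have [Tr Dr] := frob_trace_det_Fr a r1 rp cK b0.
have [g gE] := quad_exp_X (frob_trace r a b d) (frob_det r a b d) r.
by rewrite (card_quad_roots r1 rp Tr Dr cFr gE) /= [_ - 1 == 0]subr_eq0.
Qed.

Lemma card_frobenius_fixed (F : finFieldType) (h : {poly F})
    (hI : monic_irreducible_poly h) :
  #|[set c : {poly %/ h with hI} | (c ^+ #|F| == c)%R]%SET| = #|F|.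
Proof.
apply/eqP; rewrite eqn_leq; apply/andP; split.
  apply: leq_trans (_ : #|[set z : {poly %/ h with hI} |
    (1 * z ^+ #|F| + (-1) * z == 0)%R]%SET| <= _)%N.
    by apply/subset_leq_card/fintype.subsetP => z; rewrite !inE mul1r mulN1r subr_eq0.
  by apply: card_kernel_skew; rewrite ?oner_neq0 ?finNzRing_gt1.
have inj : injective (qpolyC h) by move=> x y /(congr1 val) /= /polyC_inj.
rewrite -[leqLHS](card_imset _ inj); apply/subset_leq_card/fintype.subsetP => z.
case/imsetP => c _ ->; rewrite inE; apply/eqP.
rewrite -[LHS](rmorphXn (qpolyC h)); congr (qpolyC h _).
exact: expf_card.
Qed.

Lemma collision_count_formula (I : instance) :
  collision_count I (@collision_formula (quot I) (inst_r I) (inst_d I)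
    (target I)`_(inst_r I) (target I)`_1).
Proof.
have r1 : (1 < inst_r I)%N by apply: finNzRing_gt1.
have rp : [pchar (quot I)].-nat (inst_r I).
  rewrite (eq_pnat _ (@pchar_qpoly _ (mu I))); exact: card_finField_pchar.
rewrite -card_roots_formula ?card_frobenius_fixed //; last exact: card_qfpoly.
rewrite /collision_count {1}(monic_additive2_form r1 (target_spec I)).
exact: decompositions_card.
Qed.

(** * A cost-bounded program logic *)

Section WeakestPrecondition.
Variable F : fieldType.
Implicit Types (n : nat -> nat) (f : nat -> F) (P : prog).

(* Total correctness with a cost budget [c]; the final state may not depend on the
   random draws [w]. *)
Definition wp P (c : nat) (Q : (nat -> nat) -> (nat -> F) -> Prop) n f : Prop :=
  exists (m : nat) n' f' (c' : nat),
    [/\ (c' <= c)%N, Q n' f' &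
        forall k c0 w, size w = m ->
          run (Config (P :: k) n f c0) w = Config k n' f' (c0 + c')].

Lemma wp_conseq P c c' (Q Q' : (nat -> nat) -> (nat -> F) -> Prop) n f :
  (c <= c')%N -> (forall n' f', Q n' f' -> Q' n' f') -> wp P c Q n f -> wp P c' Q' n f.
Proof.
move=> le_cc QQ [m [n' [f' [c1 [lec Qn' runP]]]]].
by exists m, n', f', c1; split=> //; [apply: leq_trans le_cc | apply: QQ].
Qed.

Lemma run_cons (s : config F) x w : run s (x :: w) = run (step s x) w.
Proof. by []. Qed.

Lemma run_cat (s : config F) w1 w2 : run s (w1 ++ w2) = run (run s w1) w2.
Proof. exact: foldl_cat. Qed.

(** The common source of the rules for single commands: one step of cost [e] replaces [P] by the
    commands [P'], never more than two. *)
Lemma wp_step1 P (P' : seq prog) c Q n f n' f' (e : nat) :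
  (e <= c)%N ->
  (forall k c0 x, step (Config (P :: k) n f c0) x = Config (P' ++ k) n' f' (c0 + e)) ->
  match P' with
  | [::] => Q n' f'
  | [:: P1] => wp P1 (c - e) Q n' f'
  | [:: P1; P2] =>
      exists2 c1, (c1 <= c - e)%N &
        wp P1 c1 (fun n f => wp P2 (c - e - c1) Q n f) n' f'
  | _ => False
  end ->
  wp P c Q n f.
Proof.
move=> le_ec stepP; case: P' stepP => [|P1 [|P2 [|//]]] stepP.
- move=> Qn'; exists 1%N, n', f', e; split=> // k c0 [|x [|]] //= _.
  exact: stepP.
- move=> [m [n1 [f1 [c1 [lec Qn1 runP]]]]].
  exists m.+1, n1, f1, (e + c1)%N; split=> //; first by lia.
  by move=> k c0 [|x w] // [sw]; rewrite run_cons stepP runP // addnA.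
move=> [c1 le1 [m [n1 [f1 [c2 [lec2 [m' [n2 [f2 [c3 [lec3 Q2 run2]]]]] run1]]]]]].
exists (m + m').+1, n2, f2, (e + (c2 + c3))%N; split=> //; first lia.
move=> k c0 [|x w] // [sw]; rewrite run_cons stepP -(cat_take_drop m w).
rewrite run_cat run1 ?size_takel ?sw ?leq_addr //.
by rewrite run2 ?size_drop ?sw ?addKn // !addnA.
Qed.

Lemma wp_skip Q n f : Q n f -> wp Skip 0 Q n f.
Proof.
by move=> Qnf; apply: (@wp_step1 _ [::] _ _ _ _ n f 0) => // k c0 x /=; rewrite addn0.
Qed.

Lemma wp_seq P1 P2 c1 c2 Q n f :
  wp P1 c1 (fun n f => wp P2 c2 Q n f) n f -> wp (Seq P1 P2) (c1 + c2) Q n f.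
Proof.
move=> H; apply: (@wp_step1 _ [:: P1; P2] _ _ _ _ n f 0) => // [k c0 x /=|].
  by rewrite addn0.
by exists c1; rewrite subn0 ?leq_addr // addKn.
Qed.

Lemma wp_if e P1 P2 c Q n f :
  (neval n e != 0%N -> wp P1 c Q n f) -> (neval n e = 0%N -> wp P2 c Q n f) ->
  wp (If e P1 P2) c Q n f.
Proof.
move=> H1 H2.
apply: (@wp_step1 _ [:: if neval n e != 0%N then P1 else P2] _ _ _ _ n f 0) => //.
  by move=> k c0 x /=; rewrite addn0.
by rewrite subn0; case: eqP => [/H2|/eqP/H1].
Qed.

Lemma wp_while_true e P c1 c2 Q n f : neval n e != 0%N ->
  wp P c1 (fun n f => wp (While e P) c2 Q n f) n f ->
  wp (While e P) (c1 + c2) Q n f.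
Proof.
move=> e0 H; apply: (@wp_step1 _ [:: P; While e P] _ _ _ _ n f 0) => //.
  by move=> k c0 x /=; rewrite addn0 e0.
by exists c1; rewrite subn0 ?leq_addr // addKn.
Qed.

Lemma wp_while_false e P Q n f : neval n e = 0%N -> Q n f -> wp (While e P) 0 Q n f.
Proof.
move=> e0 Qnf; apply: (@wp_step1 _ [::] _ _ _ _ n f 0) => // k c0 x /=.
by rewrite addn0 e0.
Qed.

Lemma wp_nstore a e Q n f :
  Q (update n (neval n a) (neval n e)) f -> wp (NStore a e) 0 Q n f.
Proof.
by move=> H; apply: (wp_step1 (P' := [::]) (e := 0) _ _ H) => // k c0 x /=; rewrite addn0.
Qed.

Lemma wp_fconst a (b : bool) Q n f :
  Q n (update f (neval n a) b%:R) -> wp (FConst a b) 0 Q n f.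
Proof.
by move=> H; apply: (wp_step1 (P' := [::]) (e := 0) _ _ H) => // k c0 x /=; rewrite addn0.
Qed.

Lemma wp_fcopy a x Q n f :
  Q n (update f (neval n a) (f (neval n x))) -> wp (FCopy a x) 0 Q n f.
Proof.
by move=> H; apply: (wp_step1 (P' := [::]) (e := 0) _ _ H) => // k c0 y /=; rewrite addn0.
Qed.

Lemma wp_fop o a x y Q n f :
  Q n (update f (neval n a) (field_op_sem o (f (neval n x)) (f (neval n y)))) ->
  wp (FOp o a x y) 1 Q n f.
Proof.
by move=> H; apply: (wp_step1 (P' := [::]) (e := 1) _ _ H) => // k c0 z /=; rewrite addn1.
Qed.

Lemma wp_fiszero a x Q n f :
  Q (update n (neval n a) (nat_of_bool (f (neval n x) == 0))) f ->
  wp (FIsZero a x) 1 Q n f.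
Proof.
by move=> H; apply: (wp_step1 (P' := [::]) (e := 1) _ _ H) => // k c0 z /=; rewrite addn1.
Qed.

End WeakestPrecondition.

Definition cell (i : nat) : nexp := NLoad (NConst i).

(* The counter takes the values [e - 1], ..., [1], [0] in the successive runs
   of the body, and is left at [0]. *)
Definition For (i : nat) (e : nexp) (body : prog) : prog :=
  Seq (NStore (NConst i) e)
      (While (cell i)
         (Seq (NStore (NConst i) (NOp OSub (cell i) (NConst 1))) body)).

(** [Inv k] is to hold when [k] runs of the body remain. The counter is thus the variant, and the
    body has to hand it back intact. *)
Lemma wp_for (F : fieldType) (Inv : nat -> (nat -> nat) -> (nat -> F) -> Prop)
    i e body c Q n f :
  Inv (neval n e) (update n i (neval n e)) f ->
  (forall k n' f', Inv k.+1 n' f' -> (k < neval n e)%N ->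
     wp body c (fun n'' f'' => n'' i = k /\ Inv k n'' f'') (update n' i k) f') ->
  (forall n' f', Inv 0%N n' f' -> n' i = 0%N -> Q n' f') ->
  wp (For i e body) (neval n e * c) Q n f.
Proof.
move=> Inv0 stepI endI; rewrite -[(neval n e * c)%N]add0n.
apply: wp_seq; apply: wp_nstore => /=.
have : update n i (neval n e) i = neval n e by rewrite /update eqxx.
move: (update n i _) Inv0 => n0; move: (neval n e) stepI => k.
elim: k n0 f => [|k IH] n0 f0 stepI Ik n0i.
  by apply: wp_while_false; [|apply: endI].
rewrite mulSn; apply: wp_while_true; first by rewrite /= n0i.
rewrite -[c in wp _ c]add0n; apply: wp_seq; apply: wp_nstore.
rewrite /= n0i subn1 /=; apply: wp_conseq (stepI k n0 f0 Ik (ltnSn k)) => //.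
move=> n1 f1 [n1i I1]; apply: IH => // k' n' f' Ik' lt; apply: stepI => //.
exact: ltnW.
Qed.

(** * Vector registers and arithmetic in F_q *)

Lemma update_eq (T : Type) (m : nat -> T) i v : update m i v i = v.
Proof. by rewrite /update eqxx. Qed.

Lemma update_neq (T : Type) (m : nat -> T) i v j : j != i -> update m i v j = m j.
Proof. by rewrite /update => /negPf->. Qed.

Section Registers.
Variables (F : finFieldType) (h : {poly F}) (hI : monic_irreducible_poly h).
Local Notation K := {poly %/ h with hI}.
Let d := (size h).-1.
Implicit Types (n : nat -> nat) (rho : nat -> K) (Q : (nat -> nat) -> (nat -> K) -> Prop).

Let d_gt0 : (0 < d)%N.
Proof. by have [[+ _] _] := hI; rewrite /d; case: (size h) => [|[]]. Qed.

Let size_h : size h = d.+1.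
Proof. by rewrite /d prednK // (leq_trans _ hI.1.1). Qed.

Definition vec (g : nat -> F) : K := in_qpoly h (\poly_(i < d) g i).

Lemma coef_vec g i : (vec g : {poly F})`_i = if (i < d)%N then g i else 0.
Proof.
rewrite /vec in_qpoly_small ?coef_poly // (mk_monicE hI) size_h ltnS.
exact: size_poly.
Qed.

Lemma coef_quot_ge (x : K) i : (d <= i)%N -> (x : {poly F})`_i = 0.
Proof.
move=> di; rewrite nth_default // (leq_trans _ di) //.
by rewrite -ltnS (leq_trans (size_mk_monic x)) // (mk_monicE hI) size_h.
Qed.

Lemma quotP (x y : K) :
  (forall i, (i < d)%N -> (x : {poly F})`_i = (y : {poly F})`_i) -> x = y.
Proof.
move=> e; apply/val_inj/polyP => i /=; case: (ltnP i d) => [/e//|di].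
by rewrite !coef_quot_ge.
Qed.

Definition reg (f : nat -> F) (j : nat) : K := vec (fun i => f (j * d + i)%N).

Definition block (f : nat -> F) (j : nat) (g : nat -> F) : nat -> F :=
  fun p => if (p %/ d == j)%N then g (p %% d)%N else f p.

Lemma block_div j i : (i < d)%N -> ((j * d + i) %/ d = j)%N.
Proof. by move=> id; rewrite divnMDl // divn_small // addn0. Qed.

Lemma block_mod j i : (i < d)%N -> ((j * d + i) %% d = i)%N.
Proof. by move=> id; rewrite modnMDl modn_small. Qed.

Lemma reg_coef f j i : (i < d)%N -> (reg f j : {poly F})`_i = f (j * d + i)%N.
Proof. by move=> id; rewrite coef_vec id. Qed.

Lemma reg_block f j g : reg (block f j g) = update (reg f) j (vec g).
Proof.
apply/funext => k; rewrite /update; apply: quotP => i id.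
rewrite reg_coef // /block block_div // block_mod //.
by case: eqP => _; rewrite ?coef_vec ?reg_coef // id.
Qed.

Definition elt (j : nat) (e : nexp) : nexp :=
  NOp OAdd (NOp OMul (NConst j) (cell 1)) e.

(** The loop descends, so when coordinate [k] is written those above it already hold [g]. Cell 2
    ends at 0, the value required at the start, so the nat memory is restored. *)
Lemma wp_block (j : nat) g P c (Q : (nat -> nat) -> (nat -> F) -> Prop) n f :
  n 1%N = d -> n 2%N = 0%N ->
  (forall k f', (k < d)%N ->
     (forall p, f' p = if (p %/ d == j)%N && (k < p %% d)%N then g (p %% d)%N else f p) ->
     wp P c (fun n' f'' => n' = update n 2 k /\ f'' = update f' (j * d + k) (g k))
       (update n 2 k) f') ->
  Q n (block f j g) -> wp (For 2 (cell 1) P) (d * c) Q n f.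
Proof.
move=> n1 n2 stepP Qend.
have -> : (d * c = neval n (cell 1) * c)%N by rewrite /= n1.
pose Inv k n' f' := n' = update n 2 k /\
  forall p, f' p = if (p %/ d == j)%N && (k <= p %% d)%N then g (p %% d)%N else f p.
apply: (@wp_for _ Inv) => /=.
- by rewrite n1; split=> // p; rewrite leqNgt ltn_mod d_gt0 andbF.
- move=> k n' f' [-> f'E]; rewrite n1 => kd.
  have -> : update (update n 2 k.+1) 2 k = update n 2 k.
    by apply/funext => p; rewrite /update; case: eqP.
  apply: wp_conseq (stepP k f' kd f'E) => // n1' f1 [-> ->]; split.
    by rewrite /update eqxx.
  split=> // p; rewrite /update; have [->|pk] := eqVneq.
    by rewrite block_div // block_mod // eqxx leqnn.
  rewrite f'E [in RHS]leq_eqVlt; case: eqP => //= pj; case: eqP => //= kp.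
  by rewrite -pj kp -divn_eq eqxx in pk.
move=> n' f' [-> f'E] _; have -> : update n 2 0 = n.
  by apply/funext => p; rewrite /update; case: eqP => // ->.
rewrite (_ : f' = block f j g) //; apply/funext => p; rewrite f'E /block leq0n andbT //.
Qed.

(** Every field cell lies in exactly one register, as d > 0. Specifications can therefore speak of
    elements of F_q instead of cells. *)
Definition rwp P c (Q : (nat -> nat) -> (nat -> K) -> Prop) n (rho : nat -> K) : Prop :=
  forall f, reg f = rho -> wp P c (fun n f => Q n (reg f)) n f.

Lemma rwp_conseq P c c' (Q Q' : (nat -> nat) -> (nat -> K) -> Prop) n rho :
  (c <= c')%N -> (forall n' rho', Q n' rho' -> Q' n' rho') -> rwp P c Q n rho ->
  rwp P c' Q' n rho.
Proof. by move=> le QQ H f /H; apply: wp_conseq => // n' f'; apply: QQ. Qed.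

Lemma rwp_skip Q n rho : Q n rho -> rwp Skip 0 Q n rho.
Proof. by move=> H f fE; apply: wp_skip; rewrite fE. Qed.

Lemma rwp_seq P1 P2 c1 c2 Q n rho :
  rwp P1 c1 (fun n rho => rwp P2 c2 Q n rho) n rho -> rwp (Seq P1 P2) (c1 + c2) Q n rho.
Proof.
move=> H f /H H1; apply: wp_seq; apply: wp_conseq H1 => // n' f' H2.
exact: H2.
Qed.

Lemma rwp_if e P1 P2 c Q n rho :
  (neval n e != 0%N -> rwp P1 c Q n rho) -> (neval n e = 0%N -> rwp P2 c Q n rho) ->
  rwp (If e P1 P2) c Q n rho.
Proof.
by move=> H1 H2 f fE; apply: wp_if => [/H1|/H2]; apply.
Qed.

Lemma rwp_while_true e P c1 c2 Q n rho : neval n e != 0%N ->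
  rwp P c1 (fun n rho => rwp (While e P) c2 Q n rho) n rho ->
  rwp (While e P) (c1 + c2) Q n rho.
Proof.
move=> e0 H f /H H1; apply: wp_while_true => //; apply: wp_conseq H1 => // n' f' H2.
exact: H2.
Qed.

Lemma rwp_while_false e P Q n rho :
  neval n e = 0%N -> Q n rho -> rwp (While e P) 0 Q n rho.
Proof. by move=> e0 H f fE; apply: wp_while_false; rewrite ?fE. Qed.

Lemma rwp_nstore a e Q n rho :
  Q (update n (neval n a) (neval n e)) rho -> rwp (NStore a e) 0 Q n rho.
Proof. by move=> H f fE; apply: wp_nstore; rewrite fE. Qed.

Lemma rwp_for (Inv : nat -> (nat -> nat) -> (nat -> K) -> Prop) i e body c Q n rho :
  Inv (neval n e) (update n i (neval n e)) rho ->
  (forall k n' rho', Inv k.+1 n' rho' -> (k < neval n e)%N ->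
     rwp body c (fun n'' rho'' => n'' i = k /\ Inv k n'' rho'') (update n' i k) rho') ->
  (forall n' rho', Inv 0%N n' rho' -> n' i = 0%N -> Q n' rho') ->
  rwp (For i e body) (neval n e * c) Q n rho.
Proof.
move=> Inv0 stepI endI f fE.
apply: (@wp_for _ (fun k n f => Inv k n (reg f))); rewrite ?fE //.
- by move=> k n' f' Ik lt; apply: (stepI _ _ _ Ik lt f').
- by move=> n' f' Ik; apply: endI.
Qed.

(* Machine invariants: [d] is in cell 1 and the low part of the modulus in
   register 0; register 3 is a constant zero (the shift below reads the cell just
   below register 4); the scratch cells 2, 3, 4 and registers 4, 5 are zero
   between operations. *)
Definition ready (n : nat -> nat) (rho : nat -> K) : Prop :=
  [/\ n 1%N = d, n 2%N = 0%N, n 3%N = 0%N, n 4%N = 0%N &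
   [/\ rho 0%N = vec (fun i => h`_i), rho 3%N = 0, rho 4%N = 0 & rho 5%N = 0]].

Definition vop (o : field_op) (dst x y : nat) : prog :=
  For 2 (cell 1) (FOp o (elt dst (cell 2)) (elt x (cell 2)) (elt y (cell 2))).

Definition vcopy (dst x : nat) : prog :=
  For 2 (cell 1) (FCopy (elt dst (cell 2)) (elt x (cell 2))).

Definition vzero (dst : nat) : prog :=
  For 2 (cell 1) (FConst (elt dst (cell 2)) false).

Definition vone (dst : nat) : prog :=
  Seq (vzero dst) (FConst (elt dst (NConst 0)) true).

Definition vscale (dst : nat) (a : nexp) (y : nat) : prog :=
  For 2 (cell 1) (FOp FMul (elt dst (cell 2)) a (elt y (cell 2))).

(* For [i = 0] the source is the last, zero, cell of register 3. *)
Definition vshift : prog :=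
  For 2 (cell 1) (FCopy (elt 4 (cell 2)) (NOp OSub (elt 4 (cell 2)) (NConst 1))).

Lemma rwp_vop o dst x y (v : K) Q n rho :
  n 1%N = d -> n 2%N = 0%N ->
  (forall i, (v : {poly F})`_i =
     field_op_sem o (rho x : {poly F})`_i (rho y : {poly F})`_i) ->
  Q n (update rho dst v) -> rwp (vop o dst x y) d Q n rho.
Proof.
move=> n1 n2 vE H f fE; rewrite -[d in wp _ d]muln1.
apply: (@wp_block dst (fun i => (v : {poly F})`_i)) => // [k f' kd f'E|]; last first.
  rewrite reg_block fE; congr (Q n (update rho dst _)): H.
  by apply: quotP => i id; rewrite coef_vec id.
apply: wp_fop => /=; rewrite !update_eq !(@update_neq _ n 2 k 1) // n1.
by rewrite !f'E !block_mod // ltnn !andbF vE -fE !reg_coef.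
Qed.

Lemma rwp_vadd dst x y Q n rho :
  n 1%N = d -> n 2%N = 0%N ->
  Q n (update rho dst (rho x + rho y)) -> rwp (vop FAdd dst x y) d Q n rho.
Proof. by move=> n1 n2 H; apply: rwp_vop H => // i; rewrite coefD. Qed.

Lemma rwp_vsub dst x y Q n rho :
  n 1%N = d -> n 2%N = 0%N ->
  Q n (update rho dst (rho x - rho y)) -> rwp (vop FSub dst x y) d Q n rho.
Proof. by move=> n1 n2 H; apply: rwp_vop H => // i; rewrite coefB. Qed.

Lemma rwp_vcopy dst x Q n rho :
  n 1%N = d -> n 2%N = 0%N ->
  Q n (update rho dst (rho x)) -> rwp (vcopy dst x) 0 Q n rho.
Proof.
move=> n1 n2 H f fE; rewrite -[0%N](muln0 d).
apply: (@wp_block dst (fun i => (rho x : {poly F})`_i)) => // [k f' kd f'E|]; last first.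
  rewrite reg_block fE; congr (Q n (update rho dst _)): H.
  by apply: quotP => i id; rewrite coef_vec id.
apply: wp_fcopy => /=; rewrite !update_eq !(@update_neq _ n 2 k 1) // n1.
by rewrite !f'E !block_mod // ltnn !andbF -fE !reg_coef.
Qed.

Lemma rwp_vzero dst Q n rho :
  n 1%N = d -> n 2%N = 0%N ->
  Q n (update rho dst 0) -> rwp (vzero dst) 0 Q n rho.
Proof.
move=> n1 n2 H f fE; rewrite -[0%N](muln0 d).
apply: (@wp_block dst (fun=> 0)) => // [k f' kd f'E|]; last first.
  rewrite reg_block fE; congr (Q n (update rho dst _)): H.
  by apply: quotP => i id; rewrite coef_vec id coef0.
by apply: wp_fconst => /=; rewrite !update_eq !(@update_neq _ n 2 k 1) // n1.
Qed.

Lemma rwp_vone dst Q n rho :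
  n 1%N = d -> n 2%N = 0%N ->
  Q n (update rho dst 1) -> rwp (vone dst) 0 Q n rho.
Proof.
move=> n1 n2 H; rewrite -[0%N]addn0; apply: rwp_seq; apply: rwp_vzero => // f fE.
apply: wp_fconst => /=; rewrite n1 (_ : reg _ = update rho dst 1) //.
apply/funext => j; apply: quotP => i id.
rewrite reg_coef // /update.
have [e|ne] := eqVneq (j * d + i)%N (dst * d + 0)%N.
  have jd : j = dst.
    by rewrite -(block_div j id) e block_div.
  have i0 : i = 0%N by move: e; rewrite jd => /addnI.
  by rewrite jd i0 eqxx coef1.
rewrite -reg_coef // fE /update; case: eqP => // jd.
by move: ne; rewrite jd eqn_add2l coef0 coef1 => /negPf->.
Qed.

(** The scalar is fetched anew for each coordinate, so its address must stay outside the register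
    being written, whatever the counter in cell 2. *)
Lemma rwp_vscale dst a y (s : F) Q n rho :
  n 1%N = d -> n 2%N = 0%N -> dst != y ->
  (forall f k, reg f = rho -> (neval (update n 2 k) a %/ d != dst)%N /\
     f (neval (update n 2 k) a) = s) ->
  Q n (update rho dst (s *: rho y)) -> rwp (vscale dst a y) d Q n rho.
Proof.
move=> n1 n2 dy aE H f fE; rewrite -[d in wp _ d]muln1.
apply: (@wp_block dst (fun i => s * (rho y : {poly F})`_i)) => // [k f' kd f'E|]; last first.
  rewrite reg_block fE; congr (Q n (update rho dst _)): H.
  by apply: quotP => i id; rewrite coef_vec id coefZ.
apply: wp_fop => /=; rewrite !update_eq !(@update_neq _ n 2 k 1) // n1.
have [ad as_] := aE f k fE.
by rewrite !f'E (negPf ad) /= as_ block_div // [y == dst]eq_sym (negPf dy) -fE /= reg_coef.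
Qed.

Lemma rwp_vshift Q n rho :
  n 1%N = d -> n 2%N = 0%N -> rho 3%N = 0 ->
  Q n (update rho 4%N (vec (fun i => if i is i'.+1 then (rho 4%N : {poly F})`_i' else 0))) ->
  rwp vshift 0 Q n rho.
Proof.
move=> n1 n2 rho3 H f fE; rewrite -[0%N](muln0 d).
apply: (@wp_block 4 (fun i => if i is i'.+1 then (rho 4%N : {poly F})`_i' else 0)) => //
  [k f' kd f'E|]; last by rewrite reg_block fE.
apply: wp_fcopy => /=; rewrite !update_eq !(@update_neq _ n 2 k 1) // n1; split=> //.
congr update; case: k kd f'E => [|k] kd f'E.
  have -> : (4 * d + 0 - 1 = 3 * d + d.-1)%N by lia.
  have d1 : (d.-1 < d)%N by rewrite prednK.
  by rewrite f'E block_div // -reg_coef // fE rho3 coef0.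
(* Since the loop descends, coordinate [k] has not been overwritten yet when it is copied to
   [k.+1]. *)
have kd' : (k < d)%N by apply: ltnW.
have -> : (4 * d + k.+1 - 1 = 4 * d + k)%N by lia.
by rewrite f'E block_div // block_mod // ltnNge leqnSn andbF -reg_coef // fE.
Qed.

Let t : K := in_qpoly h 'X.

Lemma in_qpolyK (x : K) : in_qpoly h (x : {poly F}) = x.
Proof. exact/val_inj/in_qpoly_small/size_mk_monic. Qed.

(** Both sides come from X x - c h, where c is the top coordinate of x and h is 0 in the quotient.
    As h is monic, its term of degree d cancels the one that the truncated shift drops. *)
Lemma shift_reduce (x : K) :
  vec (fun i => if i is i'.+1 then (x : {poly F})`_i' else 0)
  - (x : {poly F})`_d.-1 *: (vec (fun i => h`_i)) = t * x.
Proof.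
have hE : in_qpoly h h = 0.
  by apply/val_inj; rewrite /= (mk_monicE hI) Pdiv.RingMonic.rmodpp // hI.2.
rewrite -[in RHS](in_qpolyK x) /t -in_qpolyM -[RHS]subr0 -(scaler0 _ (x : {poly F})`_d.-1) -hE.
rewrite /vec -!in_qpolyZ -!raddfB; congr in_qpoly; apply/polyP => i.
rewrite coefB coefZ [RHS]coefB coefZ coefXM !coef_poly.
have lh : h`_d = 1 by have /monicP := hI.2; rewrite lead_coefE.
case: (ltngtP i d) => [id|di|->].
- by case: i id.
- have hi0 : h`_i = 0 by rewrite nth_default ?size_h.
  have xi0 : (x : {poly F})`_i.-1 = 0 by apply: coef_quot_ge; rewrite -ltnS prednK // (leq_trans _ di).
  by rewrite hi0 xi0 if_same.
by rewrite lh (gtn_eqF d_gt0) mulr1 mulr0 subr0 subrr.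
Qed.

(** Horner's scheme in t, with reduction after each shift. The top coordinate times the low part of
    the modulus is put into register 5 before the shift loses it. Each of the d rounds has four
    vector operations of cost d. *)
Definition vmul (dst x y : nat) : prog :=
  Seq (vzero 4) (Seq
    (For 3 (cell 1)
      (Seq (vscale 5 (elt 4 (NOp OSub (cell 1) (NConst 1))) 0)
      (Seq vshift
      (Seq (vop FSub 4 4 5)
      (Seq (vscale 5 (elt x (cell 3)) y) (vop FAdd 4 4 5))))))
  (Seq (vcopy dst 4) (Seq (vzero 4) (vzero 5)))).

(** The Horner accumulator once the coordinates of x from [k] upwards have been processed: 0 at
    [k = d] and x y at [k = 0]. *)
Let horner_tail (x y : K) k : K := in_qpoly h (drop_poly k (x : {poly F})) * y.

Let horner_tailS (x y : K) k :
  horner_tail x y k = t * horner_tail x y k.+1 + (x : {poly F})`_k *: y.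
Proof.
rewrite /horner_tail (_ : drop_poly k _ = 'X * drop_poly k.+1 x + ((x : {poly F})`_k)%:P).
  rewrite (rmorphD (in_qpoly h)) (rmorphM (in_qpoly h)) mulrDl mulrA; congr (_ + _).
  by rewrite -alg_polyC /= in_qpolyZ in_qpoly1 -scalerAl mul1r.
apply/polyP => i; rewrite coefD coefXM coefC !coef_drop_poly.
by case: i => [|i]; rewrite ?add0r //= addr0 addSnnS.
Qed.

Lemma rwp_vmul dst x y Q n rho :
  ready n rho -> (5 < dst)%N -> x != 4%N -> x != 5%N -> y != 4%N -> y != 5%N ->
  Q n (update rho dst (rho x * rho y)) -> rwp (vmul dst x y) (4 * d ^ 2) Q n rho.
Proof.
move=> [n1 n2 n3 n4 [r0 r3 r4 r5]] dst5 x4 x5 y4 y5 H.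
have up3 k i : i != 3%N -> update n 3 k i = n i by apply: update_neq.
pose Inv k n' rho' := [/\ n' = update n 3 k, rho' 4%N = horner_tail (rho x) (rho y) k &
  forall j, j != 4%N -> j != 5%N -> rho' j = rho j].
apply: (@rwp_conseq _ (0 + (d * (4 * d) + (0 + (0 + 0)))) _ Q) => //; first by lia.
apply: rwp_seq; apply: rwp_vzero => //.
apply: rwp_seq; rewrite -{1}n1 -[n 1%N]/(neval n (cell 1)); apply: (@rwp_for Inv) => /=.
- rewrite n1; split=> // [|j j4 _]; last by rewrite update_neq.
  rewrite update_eq /horner_tail drop_poly_eq0 ?in_qpoly0 ?mul0r //.
  by rewrite -ltnS (leq_trans (size_mk_monic (rho x))) // (mk_monicE hI) size_h.
- move=> k n' rho' [-> rho4 rhoE]; rewrite n1 => kd.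
  have -> : update (update n 3 k.+1) 3 k = update n 3 k.
    by apply/funext => p; rewrite /update; case: eqP.
  have u1 : update n 3 k 1 = d by rewrite up3.
  have u2 : update n 3 k 2 = 0%N by rewrite up3.
  rewrite (_ : 4 * d = d + (0 + (d + (d + d))))%N; last by lia.
  have d1 : (d.-1 < d)%N by rewrite prednK.
  apply: rwp_seq; apply: (@rwp_vscale _ _ _ ((rho' 4%N : {poly F})`_d.-1)) => //.
    move=> f k' fE; rewrite /= !(@update_neq _ _ 2 k' 1) // u1 subn1 block_div //.
    by rewrite -fE reg_coef.
  apply: rwp_seq; apply: rwp_vshift => //; first by rewrite update_neq // rhoE.
  apply: rwp_seq; apply: rwp_vsub => //.
  rewrite !(@update_neq _ _ 4 _ 5%N) // !update_eq !(@update_neq _ _ 5 _ 4%N) //.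
  rewrite (rhoE 0%N) // r0 shift_reduce rho4.
  set rho1 := update _ 4 _.
  have rho1E j : j != 4%N -> j != 5%N -> rho1 j = rho j.
    by move=> j4 j5; rewrite /rho1 !update_neq // rhoE.
  have rho14 : rho1 4%N = t * horner_tail (rho x) (rho y) k.+1 by rewrite /rho1 update_eq.
  apply: rwp_seq; apply: (@rwp_vscale _ _ _ ((rho x : {poly F})`_k)) => //.
  + by rewrite eq_sym.
  + move=> f k' fE; rewrite /= !(@update_neq _ _ 2 k') // update_eq u1 block_div //.
    by rewrite -reg_coef // fE rho1E.
  apply: rwp_vadd => //; split; first by rewrite update_eq.
  split=> // [|j j4 j5]; last by rewrite !update_neq // rho1E.
  rewrite [in RHS]horner_tailS !update_eq (@update_neq _ _ 5 _ 4%N) //.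
  by rewrite rho14 rho1E.
move=> n' rho' [-> rho4 rhoE] _.
have un : update n 3 0 = n by apply/funext => p; rewrite /update; case: eqP => // ->.
rewrite un; apply: rwp_seq; apply: rwp_vcopy => //.
apply: rwp_seq; apply: rwp_vzero => //; apply: rwp_vzero => //.
congr (Q n _): H; apply/funext => j; rewrite rho4 /horner_tail drop_poly0l.
rewrite in_qpolyK /update.
case: (eqVneq j 5%N) => [->|j5]; first by rewrite (ltn_eqF dst5) r5.
case: (eqVneq j 4%N) => [->|j4]; first by rewrite (ltn_eqF (ltnW dst5)) r4.
by case: eqP => // _; rewrite rhoE.
Qed.

Definition viszero (z x : nat) : prog :=
  Seq (NStore (NConst z) (NConst 1)) (Seq
    (For 2 (cell 1) (Seq (FIsZero (NConst 4) (elt x (cell 2)))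
                         (NStore (NConst z) (NOp OMul (cell z) (cell 4)))))
    (NStore (NConst 4) (NConst 0))).

Lemma rwp_viszero z x Q n rho :
  ready n rho -> (4 < z)%N -> Q (update n z (nat_of_bool (rho x == 0))) rho ->
  rwp (viszero z x) d Q n rho.
Proof.
move=> [n1 n2 n3 n4 _] z4 H f fE.
have zn i : (i <= 4)%N -> (i == z) = false.
  by move=> i4; apply: ltn_eqF; apply: leq_ltn_trans z4.
have uz m v i : (i <= 4)%N -> update m z v i = m i.
  by move=> i4; rewrite update_neq ?zn.
pose Inv k n' (f' : nat -> F) := [/\ f' = f, n' 2%N = k,
  n' z = nat_of_bool [forall i : 'I_d, (k <= i)%N ==> ((rho x : {poly F})`_i == 0)] &
  forall j, j != 2%N -> j != 4%N -> j != z -> n' j = n j].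
rewrite (_ : d = 0 + (d * (1 + 0) + 0))%N; last by lia.
apply: wp_seq; apply: wp_nstore; apply: wp_seq.
rewrite (_ : d = neval (update n z 1) (cell 1)); last by rewrite /= uz.
apply: (@wp_for _ Inv) => /=.
- rewrite uz // n1; split=> //; rewrite ?update_eq //.
    rewrite update_neq 1?eq_sym ?zn // update_eq (_ : [forall i, _]) //.
    by apply/forallP => i; rewrite leqNgt ltn_ord.
  by move=> j j2 j4 jz; rewrite !update_neq.
- move=> k n' f' [-> n'2 n'z n'E]; rewrite uz // n1 => kd.
  apply: wp_seq; apply: wp_fiszero; apply: wp_nstore => /=; split.
    by rewrite update_neq ?zn // update_neq // update_eq.
  have z2 : z != 2%N by rewrite eq_sym zn.
  have z4' : z != 4%N by rewrite eq_sym zn.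
  have one_z : 1%N != z by rewrite zn.
  split=> //.
  + by rewrite update_neq ?zn // update_neq // update_eq.
  + rewrite !update_eq (@update_neq _ _ 4 _ z) // (@update_neq _ _ 2 _ z) // n'z.
    rewrite !(@update_neq _ _ 2 _ 1%N) // n'E // n1 -reg_coef // fE.
    rewrite mulnb; congr nat_of_bool; apply/andP/forallP => [[/forallP H1 H2] i|H1].
      by apply/implyP; rewrite leq_eqVlt => /predU1P[<-//|ki]; have := H1 i; rewrite ki.
    split; last by have := H1 (Ordinal kd); rewrite leqnn.
    by apply/forallP => i; apply/implyP => ki; have := H1 i; rewrite ltnW.
  + by move=> j j2 j4 jz; rewrite !update_neq // n'E.
move=> n' f' [-> _ n'z n'E] n'2; apply: wp_nstore; rewrite fE /=.
congr (Q _ rho): H; apply/funext => j; rewrite /update.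
case: (eqVneq j 4%N) => [->|j4]; first by rewrite zn // n4.
case: (eqVneq j z) => [->|jz].
  rewrite n'z; congr nat_of_bool; apply/eqP/forallP => [-> i|H1]; first by rewrite leq0n /= coef0.
  by apply: quotP => i id; have := H1 (Ordinal id); rewrite leq0n /= coef0 => /eqP.
case: (eqVneq j 2%N) => [->|j2]; rewrite ?n'2 ?n2 // ?n'E //.
Qed.

Lemma ready_nmem n rho i v : (4 < i)%N -> ready n rho -> ready (update n i v) rho.
Proof.
move=> i4 [n1 n2 n3 n4 H]; have u j : (j <= 4)%N -> update n i v j = n j.
  by move=> j4; rewrite update_neq // ltn_eqF // (leq_ltn_trans j4).
by split=> //; rewrite u.
Qed.

Lemma ready_reg n rho i v : (5 < i)%N -> ready n rho -> ready n (update rho i v).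
Proof.
move=> i5 [n1 n2 n3 n4 [r0 r3 r4 r5]]; have u j : (j <= 5)%N -> update rho i v j = rho j.
  by move=> j5; rewrite update_neq // ltn_eqF // (leq_ltn_trans j5).
by split=> //; split; rewrite u.
Qed.

End Registers.

(** * The counting program *)

(* Register conventions: [T] and [D] in 10 and 11, temporaries in 12 to 15; in
   [pair_pow], the base in 6, 7 and the result in 8, 9, and the exponent in cell 5
   of the nat memory. *)
Definition pair_mul (o1 o0 x1 x0 y1 y0 : nat) : prog :=
  Seq (vmul 12 x1 y1) (Seq (vmul 13 x1 y0) (Seq (vmul 14 x0 y1) (Seq (vmul 15 x0 y0)
  (Seq (vop FAdd 13 13 14) (Seq (vmul 14 12 10) (Seq (vop FAdd o1 14 13)
  (Seq (vmul 14 12 11) (vop FSub o0 15 14)))))))).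

Definition pair_pow (e : nexp) : prog :=
  Seq (vzero 8) (Seq (vone 9) (Seq (NStore (NConst 5) e)
    (While (cell 5)
      (Seq (If (NOp OMod (cell 5) (NConst 2)) (pair_mul 8 9 8 9 6 7) Skip)
      (Seq (pair_mul 6 7 6 7 6 7)
           (NStore (NConst 5) (NOp ODiv (cell 5) (NConst 2)))))))).

Section Main.
Variables (F : finFieldType) (h : {poly F}) (hI : monic_irreducible_poly h).
Local Notation K := {poly %/ h with hI}.
Let d := (size h).-1.
Implicit Types (n : nat -> nat) (rho : nat -> K) (Q : (nat -> nat) -> (nat -> K) -> Prop).

Let d_gt0 : (0 < d)%N.
Proof. by have [[+ _] _] := hI; rewrite /d; case: (size h) => [|[]]. Qed.

Definition agree (s : seq nat) rho rho' : Prop := forall j, j \notin s -> rho' j = rho j.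

Section Steps.
Variables (Q : (nat -> nat) -> (nat -> K) -> Prop) (n : nat -> nat) (rho : nat -> K).
Hypothesis rd : ready n rho.

(** The new state is a variable with a defining equation, which keeps states from growing into
    nested updates along straight-line code. *)
Let assign dst v : Prop :=
  forall rho', ready n rho' -> rho' = update rho dst v -> Q n rho'.

Let assignP dst v : (5 < dst)%N -> assign dst v -> Q n (update rho dst v).
Proof. by move=> dst5; apply => //; apply: ready_reg. Qed.

Lemma rwp_mul dst x y :
  [&& 5 < dst, x != 4, x != 5, y != 4 & y != 5]%N ->
  assign dst (rho x * rho y) -> rwp (vmul dst x y) (4 * d ^ 2) Q n rho.
Proof. by case/and5P => *; apply: rwp_vmul => //; apply: assignP. Qed.

Lemma rwp_add dst x y : (5 < dst)%N ->
  assign dst (rho x + rho y) -> rwp (vop FAdd dst x y) d Q n rho.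
Proof. by case: rd => *; apply: rwp_vadd => //; apply: assignP. Qed.

Lemma rwp_sub dst x y : (5 < dst)%N ->
  assign dst (rho x - rho y) -> rwp (vop FSub dst x y) d Q n rho.
Proof. by case: rd => *; apply: rwp_vsub => //; apply: assignP. Qed.

Lemma rwp_copy dst x : (5 < dst)%N ->
  assign dst (rho x) -> rwp (vcopy dst x) 0 Q n rho.
Proof. by case: rd => *; apply: rwp_vcopy => //; apply: assignP. Qed.

Lemma rwp_zero dst : (5 < dst)%N -> assign dst 0 -> rwp (vzero dst) 0 Q n rho.
Proof. by case: rd => *; apply: rwp_vzero => //; apply: assignP. Qed.

Lemma rwp_one dst : (5 < dst)%N -> assign dst 1 -> rwp (vone dst) 0 Q n rho.
Proof. by case: rd => *; apply: rwp_vone => //; apply: assignP. Qed.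

End Steps.

Let not_temp v := ((5 < v) && (v \notin [:: 10; 11; 12; 13; 14; 15]))%N.

Let not_tempE v : not_temp v ->
  ((v == 12) = false) * ((v == 13) = false) * ((v == 14) = false) * ((v == 15) = false)
  * ((10 == v) = false) * ((11 == v) = false) * ((12 == v) = false) * ((13 == v) = false)
  * ((14 == v) = false) * ((15 == v) = false) * ((v == 4) = false) * ((v == 5) = false) * ((5 < v)%N = true).
Proof.
rewrite /not_temp !inE !negb_or => /andP[v5 /and5P[a0 a1 a2 a3 /andP[a4 a5]]].
rewrite ![_ == v]eq_sym !(negbTE a0, negbTE a1, negbTE a2, negbTE a3, negbTE a4, negbTE a5) v5.
by rewrite !gtn_eqF // ltnW.
Qed.

(** All products of inputs are formed in temporaries before an output is written, so outputs may
    coincide with inputs, as in squaring. *)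
Lemma rwp_pair_mul o1 o0 x1 x0 y1 y0 Q n rho :
  ready n rho ->
  not_temp x1 -> not_temp x0 -> not_temp y1 -> not_temp y0 -> not_temp o1 -> not_temp o0 ->
  o1 != o0 ->
  (forall rho', ready n rho' ->
     (rho' o1, rho' o0) =
       quad_mul (rho 10%N) (rho 11%N) (rho x1, rho x0) (rho y1, rho y0) ->
     agree [:: o1; o0; 12; 13; 14; 15]%N rho rho' -> Q n rho') ->
  rwp (pair_mul o1 o0 x1 x0 y1 y0) (27 * d ^ 2) Q n rho.
Proof.
move=> rd /not_tempE X1 /not_tempE X0 /not_tempE Y1 /not_tempE Y0 /not_tempE O1 /not_tempE O0.
move=> o10 H.
pose m := (4 * d ^ 2)%N.
(* Six products of cost 4 d^2 and three vector operations of cost d, at most d^2, make 27 d^2. *)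
apply: (@rwp_conseq _ _ _ _ (m + (m + (m + (m + (d + (m + (d + (m + d)))))))) _ Q) => //.
  have : (d <= d ^ 2)%N by rewrite -mulnn leq_pmull.
  rewrite /m; lia.
apply: rwp_seq; apply: rwp_mul => //; first by rewrite !(X1, Y1).
move=> r1 rd1 E1; apply: rwp_seq; apply: rwp_mul => //; first by rewrite !(X1, Y0).
move=> r2 rd2 E2; apply: rwp_seq; apply: rwp_mul => //; first by rewrite !(X0, Y1).
move=> r3 rd3 E3; apply: rwp_seq; apply: rwp_mul => //; first by rewrite !(X0, Y0).
move=> r4 rd4 E4; apply: rwp_seq; apply: rwp_add => //.
move=> r5 rd5 E5; apply: rwp_seq; apply: rwp_mul => //.
move=> r6 rd6 E6; apply: rwp_seq; apply: rwp_add => //; first by rewrite O1.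
move=> r7 rd7 E7; apply: rwp_seq; apply: rwp_mul => //.
move=> r8 rd8 E8; apply: rwp_sub => //; first by rewrite O0.
move=> r9 rd9 E9; apply: H => //.
  have simp := (X1, X0, Y1, Y0, O1, O0).
  do 3 (rewrite ?(E9, E8, E7) /update ?eqxx ?simp ?(negPf o10) /=).
  do 3 (rewrite ?(E6, E5, E4) /update ?eqxx ?simp /=).
  rewrite /quad_mul /=; do 3 (rewrite ?(E3, E2, E1) /update ?eqxx ?simp /=).
  by [].
move=> j; rewrite !inE !negb_or => /and5P[j1 j0 a2 a3 /andP[a4 a5]].
by rewrite E9 update_neq // E8 update_neq // E7 update_neq // E6 update_neq // E5
  update_neq // E4 update_neq // E3 update_neq // E2 update_neq // E1 update_neq.
Qed.

Let touched := [:: 6; 7; 8; 9; 12; 13; 14; 15]%N.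

(** Right-to-left binary powering: the result times the base to the remaining exponent is invariant.
    A round makes at most two pair products, whence 54 d^2, and there is one round per binary
    digit. *)
Lemma rwp_pair_pow_loop Q c n rho :
  ready n rho ->
  (forall n' rho', ready n' rho' -> n' = update n 5 0%N ->
     (rho' 8%N, rho' 9%N) = quad_mul (rho 10%N) (rho 11%N) (rho 8%N, rho 9%N)
        (quad_exp (rho 10%N) (rho 11%N) (rho 6%N, rho 7%N) (n 5%N)) ->
     agree touched rho rho' -> Q n' rho') ->
  ((if n 5%N == 0 then 0 else 54 * d ^ 2 * (trunc_log 2 (n 5%N)).+1) <= c)%N ->
  rwp (While (cell 5)
      (Seq (If (NOp OMod (cell 5) (NConst 2)) (pair_mul 8 9 8 9 6 7) Skip)
      (Seq (pair_mul 6 7 6 7 6 7)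
           (NStore (NConst 5) (NOp ODiv (cell 5) (NConst 2)))))) c Q n rho.
Proof.
move: {2}(n 5%N).+1 (ltnSn (n 5%N)) => b; elim: b n rho c => // b IH n rho c.
rewrite ltnS => eb rd H lec.
have [e0|e0] := eqVneq (n 5%N) 0%N.
  apply: (@rwp_conseq _ _ _ _ 0 _ Q) => //; apply: rwp_while_false => //.
  apply: H => //; first by apply/funext => j; rewrite /update; case: eqP => // ->.
  by rewrite e0 /quad_exp /= quad_mulC quad_mul1.
rewrite (negPf e0) in lec.
set e := n 5%N in eb e0 lec H; pose e' := (e %/ 2)%N.
pose c2 := (if e' == 0 then 0 else 54 * d ^ 2 * (trunc_log 2 e').+1)%N.
have lec2 : (54 * d ^ 2 + c2 <= c)%N.
  apply: leq_trans lec; rewrite /c2 /e' divn2; case: eqP => [_|/eqP e20].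
    by rewrite addn0 leq_pmulr.
  have e1 : (1 < e)%N by rewrite leqNgt; apply: contra e20; case: (e) => [|[|]].
  by rewrite (trunc_log2S e1) [in leqRHS]mulnS leqnn.
apply: (rwp_conseq lec2) (fun _ _ q => q) _.
apply: rwp_while_true => //.
rewrite (_ : 54 * d ^ 2 = 27 * d ^ 2 + (27 * d ^ 2 + 0))%N; last by lia.
have eodd : (e %% 2 = odd e)%N by rewrite modn2.
pose p1 := if odd e then quad_mul (rho 10%N) (rho 11%N) (rho 8%N, rho 9%N) (rho 6%N, rho 7%N)
           else (rho 8%N, rho 9%N).
pose Q1 n' rho' := [/\ n' = n, ready n rho', (rho' 8%N, rho' 9%N) = p1 &
  agree [:: 8; 9; 12; 13; 14; 15]%N rho rho'].
apply: rwp_seq; apply: (@rwp_conseq _ _ _ _ _ _ Q1 _ n rho (leqnn _)); last first.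
  apply: rwp_if => /=; rewrite -/e eodd.
    case eo: (odd e) => // _; apply: rwp_pair_mul => // rho' rd' E A; split=> //.
    by rewrite /p1 eo.
  case eo : (odd e) => // _; apply: (@rwp_conseq _ _ _ _ 0 _ Q1) => //.
  by apply: rwp_skip; split=> //; rewrite /p1 eo.
move=> _ rho1 [-> rd1 E1 A1].
apply: rwp_seq; apply: rwp_pair_mul => // rho2 rd2 E2 A2; apply: rwp_nstore => /=.
rewrite -/e -/e'.
have upd5 : update n 5 e' 5 = e' by rewrite update_eq.
apply: IH; rewrite ?upd5 //.
- by apply: leq_trans eb; rewrite /e' ltn_Pdiv // lt0n.
have uu : update (update n 5 e') 5 0%N = update n 5 0%N.
  by apply/funext => j; rewrite /update; case: eqP.
rewrite uu => n' rho' rd' eN E' A'; apply: H => //.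
- rewrite E' E2 (A2 10%N isT) (A2 11%N isT) (A2 8%N isT) (A2 9%N isT) E1.
  rewrite (A1 10%N isT) (A1 11%N isT) (A1 6%N isT) (A1 7%N isT) -quad_exp_sqr.
  rewrite -[in RHS](odd_double_half e) -divn2 -/e' /p1.
  by case: (odd e); rewrite // add1n quad_expS quad_mulA.
- move=> j jt; move: (jt); rewrite !inE !negb_or => /and5P[j6 j7 j8 j9 /and4P[j12 j13 j14 j15]].
  rewrite A' // A2; last by rewrite !inE !negb_or j6 j7 j12 j13 j14 j15.
  by rewrite A1 // !inE !negb_or j8 j9 j12 j13 j14 j15.
Qed.

Lemma rwp_pair_pow (e : nexp) Q n rho :
  ready n rho -> (1 < neval n e)%N ->
  (forall rho', ready (update n 5 0%N) rho' ->
     (rho' 8%N, rho' 9%N) = quad_exp (rho 10%N) (rho 11%N) (rho 6%N, rho 7%N) (neval n e) ->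
     agree touched rho rho' -> Q (update n 5 0%N) rho') ->
  rwp (pair_pow e) (54 * d ^ 2 * (trunc_log 2 (neval n e)).+1) Q n rho.
Proof.
move=> rd e1 H; rewrite -[(54 * _ * _)%N]add0n.
apply: rwp_seq; apply: rwp_zero => // r1 rd1 E1.
rewrite -[(54 * _ * _)%N]add0n; apply: rwp_seq; apply: rwp_one => // r2 rd2 E2.
rewrite -[(54 * _ * _)%N]add0n; apply: rwp_seq; apply: rwp_nstore => /=.
have rd2' : ready (update n 5 (neval n e)) r2 by apply: ready_nmem.
apply: rwp_pair_pow_loop => //; last first.
  by rewrite update_eq; case: eqP e1 => // ->.
have uu : update (update n 5 (neval n e)) 5 0%N = update n 5 0%N.
  by apply/funext => j; rewrite /update; case: eqP.
rewrite uu update_eq => n' r3 rd3 eN E3 A3; subst n'.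
have r2E j : j \notin touched -> r2 j = rho j.
  by rewrite !inE !negb_or => /and4P[_ _ j8 /andP[j9 _]]; rewrite E2 update_neq // E1 update_neq.
apply: H => //.
  have v8 : r2 8%N = 0 by rewrite E2 E1.
  have v9 : r2 9%N = 1 by rewrite E2.
  have v6 : r2 6%N = rho 6%N by rewrite E2 E1.
  have v7 : r2 7%N = rho 7%N by rewrite E2 E1.
  by rewrite E3 v6 v7 v8 v9 (r2E 10%N isT) (r2E 11%N isT) quad_mul1.
by move=> j jt; rewrite A3 // r2E.
Qed.

(* Registers 16, 17 hold the current pair [frob_red r a b i] and 18, 19 the previous
   one; [a] and [b] are in 1 and 2. *)
Definition frob_step : prog :=
  Seq (vcopy 18 16) (Seq (vcopy 19 17)
  (Seq (vzero 6) (Seq (vcopy 7 16) (Seq (pair_pow (cell 0)) (Seq (vcopy 20 9)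
  (Seq (vzero 6) (Seq (vcopy 7 17) (Seq (pair_pow (cell 0))
  (Seq (vmul 12 1 20) (Seq (vop FSub 16 9 12)
  (Seq (vmul 12 2 20) (vop FSub 17 3 12)))))))))))).

(** After d + 1 rounds the current and previous pairs are the two rows of M. *)
Definition frob_loop : prog :=
  Seq (vzero 16) (Seq (vone 17)
    (For 6 (NOp OAdd (cell 1) (NConst 1)) frob_step)).

Definition pow_cost (r : nat) : nat := (54 * d ^ 2 * (trunc_log 2 r).+1)%N.
Definition step_cost (r : nat) : nat :=
  (pow_cost r + (pow_cost r + (4 * d ^ 2 + (d + (4 * d ^ 2 + d)))))%N.

Lemma update_idem (m : nat -> nat) i u v : update (update m i u) i v = update m i v.
Proof. by apply/funext => j; rewrite /update; case: eqP. Qed.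

Lemma rwp_frob_step Q n rho :
  ready n rho -> (1 < n 0%N)%N ->
  (forall rho', ready (update n 5 0%N) rho' ->
     (rho' 16%N, rho' 17%N) = skew_step (n 0%N) (rho 1%N) (rho 2%N) (rho 16%N, rho 17%N) ->
     (rho' 18%N, rho' 19%N) = (rho 16%N, rho 17%N) ->
     (rho' 1%N, rho' 2%N) = (rho 1%N, rho 2%N) ->
     Q (update n 5 0%N) rho') ->
  rwp frob_step (step_cost (n 0%N)) Q n rho.
Proof.
move=> rd r1 H.
apply: (@rwp_conseq _ _ _ _ (0 + (0 + (0 + (0 + (pow_cost (n 0%N) + (0 + (0 +
  (0 + (pow_cost (n 0%N) + (4 * d ^ 2 + (d + (4 * d ^ 2 + d)))))))))))) _ Q) => //.
apply: rwp_seq; apply: rwp_copy => // r1' rd1 E1.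
apply: rwp_seq; apply: rwp_copy => // r2 rd2 E2.
apply: rwp_seq; apply: rwp_zero => // r3 rd3 E3.
apply: rwp_seq; apply: rwp_copy => // r4 rd4 E4.
apply: rwp_seq; apply: rwp_pair_pow => //= r5 rd5 E5 A5.
apply: rwp_seq; apply: rwp_copy => // r6 rd6 E6.
apply: rwp_seq; apply: rwp_zero => // r7 rd7 E7.
apply: rwp_seq; apply: rwp_copy => // r8 rd8 E8.
apply: rwp_seq; rewrite -[n 0%N]/(neval (update n 5 0%N) (cell 0)).
apply: rwp_pair_pow => //; rewrite update_idem => r9 rd9 E9 A9.
apply: rwp_seq; apply: rwp_mul => // r10 rd10 E10.
apply: rwp_seq; apply: rwp_sub => // r11 rd11 E11.
apply: rwp_seq; apply: rwp_mul => // r12 rd12 E12.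
apply: rwp_sub => // r13 rd13 E13.
(* Negation is subtraction from register 3, which holds 0. *)
have [_ _ _ _ [_ z3 _ _]] := rd12.
have e4 j : j \notin [:: 6; 7; 18; 19]%N -> r4 j = rho j.
  rewrite !inE !negb_or => /and4P[j6 j7 j18 j19].
  by rewrite E4 update_neq // E3 update_neq // E2 update_neq // E1 update_neq.
have powA : r5 9%N = rho 16%N ^+ n 0%N.
  have : r4 6%N = 0 by rewrite E4 E3.
  have : r4 7%N = rho 16%N by rewrite E4 E3 E2 E1.
  by move: E5 => /[swap] -> /[swap] ->; rewrite quad_exp_const => -[].
have powB : r9 9%N = rho 17%N ^+ n 0%N.
  have : r8 6%N = 0 by rewrite E8 E7.
  have : r8 7%N = rho 17%N by rewrite E8 E7 E6 /update /= A5 // e4.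
  by move: E9 => /[swap] -> /[swap] ->; rewrite quad_exp_const => -[].
have e8 j : j \notin [:: 6; 7; 8; 9; 12; 13; 14; 15; 18; 19; 20]%N -> r9 j = rho j.
  move=> jn; have [j6 j7] : j != 6%N /\ j != 7%N by move: jn; rewrite !inE !negb_or => /and3P[].
  have j20 : j != 20%N by apply: contraNneq jn => ->.
  have jt : j \notin touched by apply: contra jn; rewrite !inE; do !case: eqP => //=.
  rewrite A9 // E8 update_neq // E7 update_neq // E6 update_neq // A5 // e4 //.
  by apply: contra jn; rewrite !inE; do !case: eqP => //=.
have U : r9 20%N = rho 16%N ^+ n 0%N by rewrite A9 // E8 E7 E6.
have v1819 j : j \in [:: 18; 19]%N -> r9 j = r2 j.
  rewrite !inE => /orP[] /eqP ->; rewrite A9 // E8 E7 E6 /update /= A5 // E4 E3 //.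
have r91 : r9 1%N = rho 1%N by apply: e8.
have r92 : r9 2%N = rho 2%N by apply: e8.
apply: H => //.
- have v16 : r13 16%N = r9 9%N - r9 1%N * r9 20%N by rewrite E13 E12 E11 E10.
  have v17 : r13 17%N = - (r9 2%N * r9 20%N).
    by rewrite E13 update_eq z3 sub0r E12 update_eq E11 E10.
  by rewrite v16 v17 r91 r92 U powB /skew_step /= mulNr.
- have v18 j : j \in [:: 18; 19]%N -> r13 j = r9 j.
    by rewrite !inE => /orP[] /eqP ->; rewrite E13 E12 E11 E10.
  by rewrite !v18 // !v1819 // E2 E1.
have v12 j : j \in [:: 1; 2]%N -> r13 j = r9 j.
  by rewrite !inE => /orP[] /eqP ->; rewrite E13 E12 E11 E10.
by rewrite !v12 // r91 r92.
Qed.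

Lemma rwp_frob_loop Q n rho :
  ready n rho -> (1 < n 0%N)%N ->
  (forall n' rho', ready n' rho' -> n' 0%N = n 0%N ->
     (rho' 16%N, rho' 17%N) = frob_red (n 0%N) (rho 1%N) (rho 2%N) d.+1 ->
     (rho' 18%N, rho' 19%N) = frob_red (n 0%N) (rho 1%N) (rho 2%N) d ->
     (rho' 1%N, rho' 2%N) = (rho 1%N, rho 2%N) -> Q n' rho') ->
  rwp frob_loop (d.+1 * step_cost (n 0%N)) Q n rho.
Proof.
move=> rd r1 H.
rewrite -[(d.+1 * _)%N]add0n; apply: rwp_seq; apply: rwp_zero => // rho1 rd1 E1.
rewrite -[(d.+1 * _)%N]add0n; apply: rwp_seq; apply: rwp_one => // rho2 rd2 E2.
have nd : neval n (NOp OAdd (cell 1) (NConst 1)) = d.+1.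
  by case: rd => /= -> _ _ _ _; rewrite addn1.
rewrite -nd.
pose red := frob_red (n 0%N) (rho 1%N) (rho 2%N).
pose Inv k n' rho' := [/\ ready n' rho', n' 0%N = n 0%N,
  (rho' 16%N, rho' 17%N) = red (d.+1 - k)%N,
  (* The previous pair is meaningful only after the first round. *)
  (k <= d)%N -> (rho' 18%N, rho' 19%N) = red (d - k)%N &
  (rho' 1%N, rho' 2%N) = (rho 1%N, rho 2%N)].
apply: (@rwp_for _ _ _ Inv).
- rewrite nd; split; rewrite ?ltnn //.
  + by rewrite subnn E2 E1.
  + by rewrite E2 E1.
- move=> k n' rho' [rd' n'0 v16 _ v12]; rewrite nd ltnS => kd.
  rewrite -n'0 -[n' 0%N](@update_neq _ n' 6 k 0%N) //.
  apply: rwp_frob_step; [exact: ready_nmem | by rewrite update_neq // n'0 |].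
  rewrite update_neq // => rho'' rd'' w16 w18 w12; split; first by rewrite update_neq // update_eq.
  case: v12 => v1 v2; split=> //.
  + by rewrite w16 v1 v2 v16 n'0 subSS (subSn kd).
  + by move=> _; rewrite w18 v16 subSS.
  + by rewrite w12 v1 v2.
move=> n' rho' [rd' n'0 v16 v18 v12] _; apply: H => //.
by rewrite v18 // subn0.
Qed.

Definition root_count : prog :=
  Seq (vop FAdd 10 16 19)
  (Seq (vmul 12 16 19) (Seq (vmul 13 17 18) (Seq (vop FSub 11 12 13)
  (Seq (vone 6) (Seq (vzero 7) (Seq (pair_pow (cell 0))
  (Seq (viszero 7 8)
    (If (cell 7) (NStore (NConst 0) (NConst 1))
      (Seq (vone 6) (Seq (vop FSub 8 8 6) (Seq (viszero 7 8) (Seq (viszero 8 9)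
        (NStore (NConst 0) (NOp OMul (NConst 2) (NOp OMul (cell 7) (cell 8)))))))))))))))).

Definition root_count_cost (r : nat) : nat :=
  (d + (4 * d ^ 2 + (4 * d ^ 2 + (d + (0 + (0 + (pow_cost r
   + (d + (0 + (d + (d + (d + 0))))))))))))%N.

Lemma rwp_root_count Q n rho :
  ready n rho -> (1 < n 0%N)%N ->
  (forall n' rho',
     let x := quad_exp (rho 16%N + rho 19%N)
       (rho 16%N * rho 19%N - rho 17%N * rho 18%N) (1, 0) (n 0%N) in
     n' 0%N = (if x.1 == 0 then 1%N else if (x.1 - 1 == 0) && (x.2 == 0) then 2%N else 0%N) ->
     Q n' rho') ->
  rwp root_count (root_count_cost (n 0%N)) Q n rho.
Proof.
move=> rd r1 H.
apply: rwp_seq; apply: rwp_add => // rho1 rd1 E1.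
apply: rwp_seq; apply: rwp_mul => // rho2 rd2 E2.
apply: rwp_seq; apply: rwp_mul => // rho3 rd3 E3.
apply: rwp_seq; apply: rwp_sub => // rho4 rd4 E4.
apply: rwp_seq; apply: rwp_one => // rho5 rd5 E5.
apply: rwp_seq; apply: rwp_zero => // rho6 rd6 E6.
apply: rwp_seq; apply: rwp_pair_pow => // rho7 rd7 E7 A7.
have T : rho6 10%N = rho 16%N + rho 19%N by rewrite E6 E5 E4 E3 E2 E1.
have D : rho6 11%N = rho 16%N * rho 19%N - rho 17%N * rho 18%N.
  by rewrite E6 E5 E4 /update /= E3 /update /= E2 /update /= E1.
have x1 : rho6 6%N = 1 by rewrite E6 E5.
have x0 : rho6 7%N = 0 by rewrite E6.
rewrite T D x1 x0 in E7.
move: H; rewrite -[neval n (cell 0)]/(n 0%N) in E7; rewrite /= -E7 /= => H.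
apply: rwp_seq; apply: rwp_viszero => //; apply: rwp_if => /=; rewrite update_eq.
  case: (rho7 8%N =P 0) => // u0 _; apply: (@rwp_conseq _ _ _ _ 0 _ Q) => //.
  by apply: rwp_nstore; apply: H; rewrite update_eq u0 eqxx.
case: (rho7 8%N =P 0) => // /eqP u0 _.
apply: rwp_seq; apply: rwp_one => //.
move=> rho8 rd8 E8; apply: rwp_seq; apply: rwp_sub => // rho9 rd9 E9.
apply: rwp_seq; apply: rwp_viszero => //; apply: rwp_seq; apply: rwp_viszero => //.
apply: rwp_nstore; apply: H => /=; rewrite update_eq (negPf u0).
rewrite (@update_neq _ _ 8 _ 7%N) // !update_eq.
have -> : rho9 8%N = rho7 8%N - 1 by rewrite E9 E8.
have -> : rho9 9%N = rho7 9%N by rewrite E9 E8.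
by case: eqP => _ //=; case: eqP.
Qed.

Definition collision_prog : prog :=
  Seq (viszero 7 2)
  (If (cell 7)
    (Seq (viszero 7 1) (NStore (NConst 0) (NOp OSub (NConst 2) (cell 7))))
    (Seq frob_loop (Seq (viszero 7 18) (Seq (vop FSub 12 16 19) (Seq (viszero 8 12)
      (If (NOp OMul (cell 7) (cell 8))
        (NStore (NConst 0) (NOp OAdd (cell 0) (NConst 1)))
        root_count)))))).

Definition collision_cost (r : nat) : nat :=
  (d + (d.+1 * step_cost r + (d + (d + (d + root_count_cost r)))))%N.

Lemma rwp_collision_prog n rho :
  ready n rho -> (1 < n 0%N)%N ->
  rwp collision_prog (collision_cost (n 0%N))
    (fun n' _ => n' 0%N = collision_formula (n 0%N) d (rho 1%N) (rho 2%N)) n rho.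
Proof.
move=> rd r1; set Q := fun _ _ => _.
apply: rwp_seq; apply: rwp_viszero => //; apply: rwp_if => /=; rewrite update_eq.
  case: (rho 2%N =P 0) => // b0 _; apply: (@rwp_conseq _ _ _ _ (d + 0)%N _ Q) => //.
    by lia.
  apply: rwp_seq; apply: rwp_viszero => //.
  apply: rwp_nstore; rewrite /Q /collision_formula b0 eqxx /= update_eq update_eq.
  by case: eqP.
case: (rho 2%N =P 0) => // /eqP b0 _.
apply: rwp_seq; rewrite -[n 0%N](@update_neq _ n 7 false 0%N) //.
apply: rwp_frob_loop; [exact: ready_nmem | by [] |].
rewrite update_neq // => n1 rho1 rd1 n10 v16 v18 v12.
apply: rwp_seq; apply: rwp_viszero => //.
apply: rwp_seq; apply: rwp_sub => //.
move=> rho2 rd2 E2; apply: rwp_seq; apply: rwp_viszero => //.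
have [a1 b1] : rho1 18%N = (frob_red (n 0%N) (rho 1%N) (rho 2%N) d).1 /\
    rho1 19%N = (frob_red (n 0%N) (rho 1%N) (rho 2%N) d).2 by rewrite -v18.
have [a2 b2] : rho1 16%N = (frob_red (n 0%N) (rho 1%N) (rho 2%N) d.+1).1 /\
    rho1 17%N = (frob_red (n 0%N) (rho 1%N) (rho 2%N) d.+1).2 by rewrite -v16.
have w12 : rho2 12%N = rho1 16%N - rho1 19%N by rewrite E2.
set n2 := update _ 8 _.
have n20 : n2 0%N = n 0%N by rewrite -n10.
have flags : neval n2 (NOp OMul (cell 7) (cell 8)) =
    nat_of_bool ((rho1 18%N == 0) && (rho1 16%N - rho1 19%N == 0)).
  by rewrite /= /n2 update_eq (@update_neq _ _ 8 _ 7%N) // update_eq w12 mulnb.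
have rd3 : ready n2 rho2 by apply: ready_nmem.
have cf : collision_formula (n 0%N) d (rho 1%N) (rho 2%N) =
    if (rho1 18%N == 0) && (rho1 16%N - rho1 19%N == 0) then (n 0%N).+1
    else let x := quad_exp (frob_trace (n 0%N) (rho 1%N) (rho 2%N) d)
                    (frob_det (n 0%N) (rho 1%N) (rho 2%N) d) (1, 0) (n 0%N) in
         if x.1 == 0 then 1%N else if (x.1 - 1 == 0) && (x.2 == 0) then 2%N else 0%N.
  by rewrite /collision_formula (negPf b0) -a1 -b1 -a2.
apply: rwp_if; rewrite flags; case flag: (_ && _) => // _.
  apply: (@rwp_conseq _ _ _ _ 0 _ Q) => //; apply: rwp_nstore.
  by rewrite /Q update_eq cf flag /= n20 addn1.
rewrite -n20; apply: rwp_root_count => //; first by rewrite n20.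
move=> n3 rho3; rewrite n20 /Q cf flag => ->.
rewrite /frob_trace /frob_det -a1 -b1 -a2 -b2.
have e j : j != 12%N -> rho2 j = rho1 j by move=> j12; rewrite E2 update_neq.
by rewrite !e.
Qed.
End Main.

(** * Correctness and cost *)

(** The zero cells and registers demanded by [ready] come from the default value of [nth] beyond the
    input. *)
Lemma input_ready (I : instance) :
  let rho := reg (mu_irr I) (@input_fmem I) in
  [/\ ready (input_nmem I) rho, rho 1%N = (target I)`_(inst_r I) & rho 2%N = (target I)`_1].
Proof.
move=> rho.
have inE j i : (i < inst_d I)%N -> @input_fmem I (j * inst_d I + i)%N =
    if j == 0%N then (mu I)`_i else
    if j == 1%N then ((target I)`_(inst_r I) : {poly Fr I})`_i else
    if j == 2%N then ((target I)`_1 : {poly Fr I})`_i else 0.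
  move=> id; rewrite /input_fmem !nth_cat !size_mkseq.
  case: j => [|[|[|j]]] /=.
  - by rewrite mul0n add0n id nth_mkseq.
  - by rewrite mul1n ltnNge leq_addr addKn id /= nth_mkseq.
  - rewrite mul2n -addnn -addnA ltnNge leq_addr addKn ltnNge leq_addr addKn.
    by rewrite /= nth_mkseq.
  rewrite !mulSn -!addnA ltnNge leq_addr addKn ltnNge leq_addr addKn.
  by rewrite /= nth_default // size_mkseq leq_addr.
split; last 2 first.
- by apply: quotP => i id; rewrite reg_coef // inE.
- by apply: quotP => i id; rewrite reg_coef // inE.
split=> //; split; apply: quotP => i id; rewrite reg_coef ?inE //.
- by rewrite coef_vec id.
- by rewrite coef0.
- by rewrite coef0.
- by rewrite coef0.
Qed.

Lemma run_halted (F : fieldType) (s : config F) w : halted s -> run s w = s.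
Proof.
by case: s => -[] // n f c _; elim: w => //= x w IH.
Qed.

Lemma cost_step (F : fieldType) (s : config F) x : (cost s <= cost (step s x))%N.
Proof. by case: s => -[|[] *] //=; rewrite leqnSn. Qed.

Lemma cost_run (F : fieldType) (s : config F) w : (cost s <= cost (run s w))%N.
Proof.
elim: w s => //= x w IH s; exact: leq_trans (cost_step s x) (IH _).
Qed.

Lemma exec_cat P (I : instance) w1 w2 : @exec P I (w1 ++ w2) = run (@exec P I w1) w2.
Proof. exact: foldl_cat. Qed.

(** [wp] describes words of length exactly [m]. Longer words leave the halted state alone. Shorter
    ones are padded with zeros, which cannot lower the cost and changes nothing after a halt. *)
Lemma exec_collision_prog (I : instance) : exists m,
  (forall w, (m <= size w)%N -> halted (@exec collision_prog I w)) /\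
  forall w, (cost (@exec collision_prog I w) <= collision_cost (mu I) (inst_r I))%N /\
    (halted (@exec collision_prog I w) ->
     collision_count I (output (@exec collision_prog I w))).
Proof.
have [rd a1 b1] := input_ready I.
have r1 : (1 < input_nmem I 0)%N by apply: finNzRing_gt1.
have [m [n' [f' [c' [lec out runP]]]]] := rwp_collision_prog rd r1 erefl.
have full w : (m <= size w)%N -> @exec collision_prog I w = Config [::] n' f' c'.
  move=> mw; rewrite -(cat_take_drop m w) exec_cat /exec runP ?size_takel //.
  exact: run_halted.
exists m; split=> [w mw|w]; first by rewrite full.
have mw : (m <= size (w ++ nseq m (0%R : Fr I)))%N by rewrite size_cat size_nseq leq_addl.
have := full _ mw; rewrite exec_cat => E; split.
  by apply: leq_trans (cost_run _ (nseq m (0%R : Fr I))) _; rewrite E.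
move=> hw; rewrite run_halted // in E; rewrite E /output /= out a1 b1.
exact: collision_count_formula.
Qed.

(** With L binary digits in r, two powers of cost 54 d^2 L in each of d + 1 <= 2d rounds give 216
    d^3 L. The other terms raise this to at most 308 d^3 L, and 400 leaves room. *)
Lemma collision_cost_le (F : finFieldType) (h : {poly F}) r : (1 < size h)%N -> (1 < r)%N ->
  (collision_cost h r <= 400 * ((size h).-1 ^ 3 * (trunc_log 2 r).+1))%N.
Proof.
move=> h1 r1; rewrite /collision_cost /step_cost /root_count_cost /pow_cost.
have : (0 < (size h).-1)%N by rewrite -ltnS prednK // ltnW.
move: (size h).-1 (trunc_log 2 r).+1 (ltn0Sn (trunc_log 2 r)) => d L L0 d0.
rewrite !expnS expn0 !muln1.
have h2 : (d <= d * d)%N by rewrite leq_pmull.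
have h3 : (d * d <= d * (d * d))%N by rewrite leq_pmull.
have h4 : (d * d * L <= d * (d * d) * L)%N by rewrite leq_mul.
have h5 : (d * (d * d) <= d * (d * d) * L)%N by rewrite leq_pmulr.
lia.
Qed.

(** * Real-valued bounds, expectation and halting *)

Section Asymptotics.
Variable R : realType.

(** As r >= 2, the integer logarithm is at least 1, so adding 1 at most doubles it. This absorbs the
    additive term into the constant. *)
Lemma trunc_log_le_ln (r : nat) : (1 < r)%N ->
  ((trunc_log 2 r).+1%:R : R) <= 2 / ln 2 * ln r%:R.
Proof.
move=> r1; have ln2 : 0 < ln (2 : R) by rewrite ln_gt0 // ltr1n.
rewrite mulrAC ler_pdivlMr //.
have le1 : (trunc_log 2 r)%:R * ln 2 <= ln (r%:R : R).
  rewrite mulr_natl -lnXn // -natrX ler_ln ?posrE ?ltr0n ?expn_gt0 ?(ltnW r1) //.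
  by rewrite ler_nat trunc_logP // ltnW.
have tl1 : (1 <= trunc_log 2 r)%N by rewrite trunc_log_max.
apply: le_trans (_ : 2 * ((trunc_log 2 r)%:R * ln 2) <= _); last by rewrite ler_pM2l.
rewrite mulrA ler_pM2r // -natrM ler_nat; lia.
Qed.

Definition cost_constant : R := 400 * (2 / ln 2).

Lemma cost_bound (I : instance) w :
  ((cost (@exec collision_prog I w))%:R : R) <=
    cost_constant * (inst_d I)%:R ^+ 3 * ln (inst_r I)%:R.
Proof.
have [m [_ /(_ w)[le _]]] := exec_collision_prog I.
have r1 : (1 < inst_r I)%N by apply: finNzRing_gt1.
have h1 : (1 < size (mu I))%N by have [[]] := mu_irr I.
have {}le := leq_trans le (collision_cost_le h1 r1).
apply: le_trans (_ : (400 * ((inst_d I) ^ 3 * (trunc_log 2 (inst_r I)).+1))%:R <= _).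
  by rewrite ler_nat.
rewrite /cost_constant natrM natrM natrX.
have : 0 <= (inst_d I)%:R ^+ 3 :> R by rewrite exprn_ge0.
move: ((inst_d I)%:R ^+ 3) => y y0; rewrite -!(mulrA 400) ler_pM2l ?ltr0n //.
by rewrite mulrAC [leRHS]mulrC ler_wpM2l // trunc_log_le_ln.
Qed.

Lemma mean_le (F : finFieldType) n (X : n.-tuple F -> R) B :
  (forall w, X w <= B) -> mean X <= B.
Proof.
move=> XB; rewrite /mean ler_pdivrMr; last first.
  by rewrite ltr0n expn_gt0 (ltnW (finNzRing_gt1 F)).
apply: le_trans (ler_sum _ (fun w _ => XB w)) _.
by rewrite sumr_const card_tuple mulr_natr.
Qed.

Lemma collision_prog_expected_cost (I : instance) :
  (expected_cost R collision_prog I <=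
    (cost_constant * (inst_d I)%:R ^+ 3 * ln (inst_r I)%:R)%:E)%E.
Proof.
apply: ge_ereal_sup => _ [n _ <-]; rewrite lee_fin; apply: mean_le => w.
exact: cost_bound.
Qed.

Lemma collision_prog_halts : almost_surely_halts R collision_prog.
Proof.
move=> I; have [m [halts _]] := exec_collision_prog I.
apply: cvg_near_cst; near=> n; rewrite /mean.
rewrite (eq_bigr (fun=> 1)); last first.
  move=> w _; rewrite halts // size_tuple; near: n; exact: nbhs_infty_ge.
rewrite sumr_const card_tuple divff // pnatr_eq0 -lt0n expn_gt0.
by rewrite (ltnW (finNzRing_gt1 _)).
Unshelve. all: by end_near. Qed.
End Asymptotics.

Theorem theorem4p3 (R : realType) :
  (exists P : prog,
    [/\ partially_correct P,
        almost_surely_halts R P &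
        exists C : R, forall I : instance,
          (expected_cost R P I
             <= (C * (inst_d I)%:R ^+ 3 * ln (inst_r I)%:R)%:E)%E])
  /\
  (exists P : prog,
    [/\ deterministic P,
        partially_correct P,
        always_halts P &
        extended_Riemann_hypothesis R ->
        exists (C : R) (k : nat), forall (I : instance) (w : seq (Fr I)),
          (cost (exec P w))%:R
             <= C * (inst_d I)%:R ^+ k * ln (inst_r I)%:R]).
Proof.
have correct : partially_correct collision_prog.
  by move=> I w; have [m [_ /(_ w)[]]] := exec_collision_prog I.
split; exists collision_prog; split=> //.
- exact: collision_prog_halts.
- by exists (cost_constant R) => I; apply: collision_prog_expected_cost.
- move=> I; have [m [halts _]] := exec_collision_prog I; exists m => w.
  by apply: halts; rewrite size_tuple.
- by move=> _; exists (cost_constant R), 3%N => I w; apply: cost_bound.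
Qed.
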